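(* Let $\alpha\in\mathbb{C}$. The operator $\mathcal{W}_\alpha$ is maximal accretive if $\mathrm{Re}(\alpha)\ge 0$, maximal dissipative if $\mathrm{Re}(\alpha)\le 0$, and skew-adjoint if $\mathrm{Re}(\alpha)=0$.
   Context: Fix $N\in\mathbb{N}^*=\{1,2,\dots\}$, put $\mathcal{N}=\{1,\dots,N\}$ and $\mathbb{R}_+^*=]0,+\infty[$. The star graph $\Gamma$ consists of $N$ copies of $\mathbb{R}_+^*$ joined at a central vertex $0$. A function $u$ on $\Gamma$ is a tuple $u=(u_j)_{j\in\mathcal{N}}$ of functions on $\mathbb{R}_+^*$; derivatives are taken componentwise. Put $L^2(\Gamma)=L^2(\mathbb{R}_+^* )^N$ (complex-valued functions, natural Hilbert structure) and, for $k\in\mathbb{N}^*$, $H^k(\Gamma^* )=H^k(\mathbb{R}_+^* )^N$, $\dot H^k(\Gamma^* )=\dot H^k(\mathbb{R}_+^* )^N$, where $\dot H^k(\mathbb{R}_+^* )$ is the space of locally integrable functions whose $k$-th distributional derivative is in $L^2(\mathbb{R}_+^* )$. A function $u\in\dot H^1(\Gamma^* )$ is continuous at $0$ if $u_j(0)=u_k(0)$ for all $j,k\in\mathcal{N}$; the common value is $u(0)$. Put $\dot H^1(\Gamma)=\{u\in\dot H^1(\Gamma^* ): u \text{ continuous at } 0\}$, $H^1(\Gamma)=\{u\in H^1(\Gamma^* ): u \text{ continuous at } 0\}$, and let $\tilde H^1(\Gamma)$ be the quotient of $\dot H^1(\Gamma)$ by constant functions, a Hilbert space for $\langle u,v\rangle_{\tilde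 H^1(\Gamma)}=\langle u',v'\rangle_{L^2(\Gamma)}$. Functions in $\dot H^1(\Gamma)$ are identified with their classes in $\tilde H^1(\Gamma)$. Let $\mathscr{H}=\tilde H^1(\Gamma)\times L^2(\Gamma)$. For $\alpha\in\mathbb{C}$, $\mathcal{W}_\alpha$ is the unbounded operator in $\mathscr{H}$ with domain $$\mathrm{Dom}(\mathcal{W}_\alpha)=\Big\{(u,v)\in\big(\tilde H^1(\Gamma)\cap\dot H^2(\Gamma^* )\big)\times H^1(\Gamma):\ \sum_{j=1}^N u_j'(0)+\alpha v(0)=0\Big\}$$ and action $\mathcal{W}_\alpha(u,v)=(v,u'')$. An operator $\mathcal{W}$ in $\mathscr{H}$ is accretive (dissipative) if $\mathrm{Re}\langle \mathcal{W}U,U\rangle_{\mathscr{H}}\ge 0$ (resp. $\le 0$) for all $U\in\mathrm{Dom}(\mathcal{W})$; it is maximal accretive (maximal dissipative) if moreover some $z$ with $\mathrm{Re}(z)<0$ (resp. $\mathrm{Re}(z)>0$) belongs to its resolvent set; skew-adjoint means $\mathcal{W}^*=-\mathcal{W}$. *)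

(* Defs.v *)
From HB Require Import structures.
From mathcomp Require Import all_boot all_order all_algebra.
From mathcomp Require Import all_classical all_reals all_analysis.
From mathcomp Require Import complex generic_quotient ring_quotient.
From mathcomp Require Import measurable_realfun ring lra.

Set Implicit Arguments.
Unset Strict Implicit.
Unset Printing Implicit Defensive.

Import Order.TTheory GRing.Theory Num.Theory.
Import numFieldNormedType.Exports.

Local Open Scope classical_set_scope.
Local Open Scope quotient_scope.
Local Open Scope ring_scope.
Local Open Scope complex_scope.

Local Notation Re := (@complex.Re _).
Local Notation Im := (@complex.Im _).

(* ring_quotient only equips [Quotient.quot I] with a Z-module structure. *)
Section LmodQuotient.
Variables (K : pzRingType) (V : lmodType K).
Variables (I : V -> bool) (I_closed : submod_closed I).

(* Carries [I_closed], so as to make it available to canonical structures. *)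
Definition submod_pred of submod_closed I : V -> bool := I.

Local Notation I' := (submod_pred I_closed).

HB.instance Definition _ :=
  GRing.isSubmodClosed.Build K V I' I_closed.

Definition lmod_quot : Type := @Quotient.quot V (GRing.ZmodClosed.clone V I' _).

HB.instance Definition _ := GRing.Zmodule.on lmod_quot.
HB.instance Definition _ := EqQuotient.on lmod_quot.

Definition lmod_quot_scale (a : K) (x : lmod_quot) : lmod_quot :=
  \pi_(lmod_quot) (a *: repr x).

Lemma lmod_quot_piE (x y : V) :
  \pi_(lmod_quot) x = \pi_(lmod_quot) y <-> x - y \in I'.
Proof.
have -> : (x - y \in I') = (x == y %[mod lmod_quot]).
  exact: (Quotient.idealrBE (GRing.ZmodClosed.clone V I' _)).
by split=> /eqP.
Qed.

Lemma lmod_quot_piZ (a : K) (x : V) :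
  lmod_quot_scale a (\pi_(lmod_quot) x) = \pi_(lmod_quot) (a *: x).
Proof.
apply/lmod_quot_piE; rewrite -scalerBr rpredZ//; apply/lmod_quot_piE.
by rewrite reprK.
Qed.

Lemma lmod_quot_piD (x y : V) :
  \pi_(lmod_quot) x + \pi_(lmod_quot) y = \pi_(lmod_quot) (x + y).
Proof. by rewrite [RHS]Quotient.pi_add. Qed.

Lemma lmod_quot_scaleA (a b : K) (x : lmod_quot) :
  lmod_quot_scale a (lmod_quot_scale b x) = lmod_quot_scale (a * b) x.
Proof. by rewrite -[x]reprK (lmod_quot_piZ b) !lmod_quot_piZ scalerA. Qed.

Lemma lmod_quot_scale1 : left_id 1 lmod_quot_scale.
Proof. by move=> x; rewrite -[x]reprK lmod_quot_piZ scale1r. Qed.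

Lemma lmod_quot_scaleDr : right_distributive lmod_quot_scale +%R.
Proof.
move=> a x y; rewrite -[x]reprK -[y]reprK.
by rewrite lmod_quot_piD !lmod_quot_piZ lmod_quot_piD scalerDr.
Qed.

Lemma lmod_quot_scaleDl (x : lmod_quot) :
  {morph lmod_quot_scale^~ x : a b / a + b}.
Proof.
by move=> a b; rewrite -[x]reprK !lmod_quot_piZ lmod_quot_piD scalerDl.
Qed.

HB.instance Definition _ := GRing.Zmodule_isLmodule.Build K lmod_quot
  lmod_quot_scaleA lmod_quot_scale1 lmod_quot_scaleDr lmod_quot_scaleDl.

End LmodQuotient.

Section Operators.
Variables (R : realType) (V : lmodType R[i]).
(* The inner product is linear in its first argument. *)
Variable ip : V -> V -> R[i].

(* [act] is meaningful on [dom] only. *)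
Record unbounded_op := UnboundedOp { dom : set V; act : V -> V }.

Implicit Types (W : unbounded_op).

Definition ip_norm (U : V) : R := Num.sqrt (Re (ip U U)).

Definition accretive W := forall U, dom W U -> 0 <= Re (ip (act W U) U).

Definition dissipative W := forall U, dom W U -> Re (ip (act W U) U) <= 0.

(* [S] is a bounded everywhere defined inverse of [W - z]. *)
Definition resolvent_set W : set R[i] := [set z | exists S : V -> V,
  [/\ forall F, dom W (S F) /\ act W (S F) - z *: S F = F,
      forall U, dom W U -> S (act W U - z *: U) = U
    & exists M : R, forall F, ip_norm (S F) <= M * ip_norm F]].

Definition maximal_accretive W :=
  accretive W /\ exists2 z, Re z < 0 & resolvent_set W z.

Definition maximal_dissipative W :=
  dissipative W /\ exists2 z, 0 < Re z & resolvent_set W z.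

Definition adjoint_graph W : set (V * V) :=
  [set VF | forall U, dom W U -> ip (act W U) VF.1 = ip U VF.2].

(* Equality of graphs. The adjoint of an operator whose domain is not dense is
   a multivalued relation, hence never the graph of [- W]: in a Hilbert space
   this condition includes the density of [dom W]. *)
Definition skew_adjoint W :=
  adjoint_graph W = [set VF | dom W VF.1 /\ VF.2 = - act W VF.1].

End Operators.

(* Functions on the half-line are represented by functions on [R] whose values
   outside ]0, +oo[ are irrelevant. *)
Section HalfLine.
Variable R : realType.
Local Notation mu := (@lebesgue_measure R).
Implicit Types (f g : R -> R[i]) (phi : R -> R).

Definition halfline : set R := `]0, +oo[.

Definition cintegral f : R[i] :=
  (\int[mu]_(x in halfline) Re (f x))%R
    +i* (\int[mu]_(x in halfline) Im (f x))%R.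

Definition loc_integrable f :=
  locally_integrable halfline (fun x => Re (f x)) /\
  locally_integrable halfline (fun x => Im (f x)).

Definition L2 f :=
  [/\ measurable_fun halfline (fun x => Re (f x)),
      measurable_fun halfline (fun x => Im (f x))
    & (\int[mu]_(x in halfline) (Re (f x) ^+ 2 + Im (f x) ^+ 2)%:E < +oo)%E].

Definition test_function phi :=
  (forall n x, derivable (derive1n n phi) x 1) /\
  exists a b : R, 0 < a /\ forall x, x \notin `[a, b] -> phi x = 0.

(* Real-valued test functions suffice, by complex linearity. *)
Definition distr_deriv (k : nat) f g := forall phi, test_function phi ->
  cintegral (fun x => (derive1n k phi x)%:C * f x) =
  (- 1) ^+ k * cintegral (fun x => (phi x)%:C * g x).

Definition Hdot (k : nat) f :=
  loc_integrable f /\ exists2 g, L2 g & distr_deriv k f g.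

Definition Hsob (k : nat) f :=
  L2 f /\ forall l, (l <= k)%N -> exists2 g, L2 g & distr_deriv l f g.

(* The [k]-th distributional derivative of [f] when it belongs to L^2. *)
Definition dderiv (k : nat) f : R -> R[i] :=
  xget (fun=> 0) [set g | L2 g /\ distr_deriv k f g].

(* The continuous representative [g] of [f] takes the value [c] at 0. *)
Definition has_trace f (c : R[i]) := exists g,
  [/\ ae_eq mu halfline f g,
      forall x, halfline x ->
        {for x, continuous (fun y => Re (g y))} /\
        {for x, continuous (fun y => Im (g y))},
      Re (g x) @[x --> 0^'+] --> Re c
    & Im (g x) @[x --> 0^'+] --> Im c].

Definition cintegrable f :=
  mu.-integrable halfline (fun x => (Re (f x))%:E) /\
  mu.-integrable halfline (fun x => (Im (f x))%:E).

Lemma halfline_open : open halfline.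
Proof. exact: interval_open. Qed.

Lemma halfline_measurable : @measurable _ (measurableTypeR R) halfline.
Proof. exact: measurable_itv. Qed.

Lemma ReM (x y : R[i]) : Re (x * y) = Re x * Re y - Im x * Im y.
Proof. by case: x y => [a b] [c d]. Qed.

Lemma ImM (x y : R[i]) : Im (x * y) = Re x * Im y + Im x * Re y.
Proof. by case: x y => [a b] [c d]. Qed.

Lemma ReD (x y : R[i]) : Re (x + y) = Re x + Re y.
Proof. by case: x y => [a b] [c d]. Qed.

Lemma ImD (x y : R[i]) : Im (x + y) = Im x + Im y.
Proof. by case: x y => [a b] [c d]. Qed.

Lemma cintegrable_lin (a : R[i]) f g : cintegrable f -> cintegrable g ->
  cintegrable (fun x => a * f x + g x) /\
  cintegral (fun x => a * f x + g x) = a * cintegral f + cintegral g.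
Proof.
move=> [f1 f2] [g1 g2]; have mD := halfline_measurable.
have Z (c : R) (h : R -> R) : mu.-integrable halfline (EFin \o h) ->
    mu.-integrable halfline (EFin \o (fun x => c * h x)).
  move=> hi; have := integrableZl mD c hi.
  by apply: eq_integrable => // x _; rewrite /= EFinM.
have D (h k : R -> R) : mu.-integrable halfline (EFin \o h) ->
    mu.-integrable halfline (EFin \o k) ->
    mu.-integrable halfline (EFin \o (fun x => h x + k x)).
  move=> hi ki; have := integrableD mD hi ki.
  by apply: eq_integrable => // x _; rewrite /= EFinD.
have E1 : (fun x => Re (a * f x + g x)) =
    (fun x => (Re a * Re (f x) + (- Im a) * Im (f x)) + Re (g x)).
  by apply/funext => x; rewrite ReD ReM mulNr.
have E2 : (fun x => Im (a * f x + g x)) =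
    (fun x => (Re a * Im (f x) + Im a * Re (f x)) + Im (g x)).
  by apply/funext => x; rewrite ImD ImM.
split.
  split.
    change (mu.-integrable halfline (EFin \o (fun x => Re (a * f x + g x)))).
    by rewrite E1; apply: (D) => //; apply: (D); apply: (Z).
  change (mu.-integrable halfline (EFin \o (fun x => Im (a * f x + g x)))).
  by rewrite E2; apply: (D) => //; apply: (D); apply: (Z).
rewrite /cintegral E1 E2 !RintegralD ?RintegralZl//;
  try by [apply: (Z) | apply: (D); apply: (Z)].
by case: a {E1 E2} => a b; rewrite mulNr.
Qed.

Lemma measurable_lin (a : R[i]) f g :
  measurable_fun halfline (fun x => Re (f x)) ->
  measurable_fun halfline (fun x => Im (f x)) ->
  measurable_fun halfline (fun x => Re (g x)) ->
  measurable_fun halfline (fun x => Im (g x)) ->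
  measurable_fun halfline (fun x => Re (a * f x + g x)) /\
  measurable_fun halfline (fun x => Im (a * f x + g x)).
Proof.
move=> f1 f2 g1 g2; split.
- have -> : (fun x => Re (a * f x + g x)) =
    (fun x => (Re a * Re (f x) + (- Im a) * Im (f x)) + Re (g x)).
    by apply/funext => x; rewrite ReD ReM mulNr.
  by do ?apply: measurable_funD => //; apply: measurable_funM.
- have -> : (fun x => Im (a * f x + g x)) =
    (fun x => (Re a * Im (f x) + Im a * Re (f x)) + Im (g x)).
    by apply/funext => x; rewrite ImD ImM.
  by do ?apply: measurable_funD => //; apply: measurable_funM.
Qed.

Lemma L2_lin (a : R[i]) f g : L2 f -> L2 g -> L2 (fun x => a * f x + g x).
Proof.
move=> [f1 f2 f3] [g1 g2 g3].
have [h1 h2] := measurable_lin a f1 f2 g1 g2; split => //.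
have mD := halfline_measurable.
have msq (u v : R -> R) : measurable_fun halfline u ->
    measurable_fun halfline v ->
    measurable_fun halfline (fun x => u x ^+ 2 + v x ^+ 2).
  by move=> mu_ mv; apply: measurable_funD; apply: measurable_funX.
have int (u v : R -> R) : measurable_fun halfline u ->
    measurable_fun halfline v ->
    (\int[mu]_(x in halfline) (u x ^+ 2 + v x ^+ 2)%:E < +oo)%E ->
    mu.-integrable halfline (EFin \o (fun x => u x ^+ 2 + v x ^+ 2)).
  move=> mu_ mv h; apply/integrableP; split.
    by apply/measurable_EFinP; exact: msq.
  apply: le_lt_trans h; rewrite le_eqVlt; apply/orP; left; apply/eqP.
  by apply: eq_integral => x _; rewrite /= ger0_norm// addr_ge0// sqr_ge0.
pose A := 2 * (Re a ^+ 2 + Im a ^+ 2).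
have := integrableD mD (integrableZl mD A (int _ _ f1 f2 f3))
  (integrableZl mD 2 (int _ _ g1 g2 g3)).
move=> H; suff : mu.-integrable halfline (EFin \o (fun x =>
    Re (a * f x + g x) ^+ 2 + Im (a * f x + g x) ^+ 2)).
  move=> /integrableP[_]; apply: le_lt_trans.
  rewrite le_eqVlt; apply/orP; left; apply/eqP.
  by apply: eq_integral => x _; rewrite /= ger0_norm// addr_ge0// sqr_ge0.
apply: le_integrable H => //.
  by apply/measurable_EFinP; exact: msq.
move=> x _ /=; rewrite lee_fin !ger0_norm; first last.
- by rewrite addr_ge0// sqr_ge0.
- by rewrite addr_ge0// ?mulr_ge0// ?addr_ge0// ?sqr_ge0.
rewrite ReD ImD ReM ImM /A.
case: (f x) (g x) a {A h1 h2} => [p q] [r s] [t u] /=.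
rewrite -subr_ge0.
have -> : 2 * (t ^+ 2 + u ^+ 2) * (p ^+ 2 + q ^+ 2) + 2 * (r ^+ 2 + s ^+ 2) -
   ((t * p - u * q + r) ^+ 2 + (t * q + u * p + s) ^+ 2) =
   (t * p - u * q - r) ^+ 2 + (t * q + u * p - s) ^+ 2 by ring.
by rewrite addr_ge0// sqr_ge0.
Qed.

Lemma loc_integrable_lin (a : R[i]) f g :
  loc_integrable f -> loc_integrable g ->
  loc_integrable (fun x => a * f x + g x).
Proof.
have Z (c : R) (h : R -> R) : locally_integrable halfline h ->
    locally_integrable halfline (fun x => c * h x).
  move=> [mh oD ih]; split => //; first exact: measurable_funM.
  move=> K KD cK.
  have mK : @measurable _ (measurableTypeR R) K by exact: compact_measurable.
  have : mu.-integrable K (EFin \o h).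
    apply/integrableP; split; last exact: ih.
    apply/measurable_EFinP; apply: measurable_funS mh => //.
    exact: halfline_measurable.
  by move=> /(integrableZl mK c) /integrableP[_].
move=> [f1 f2] [g1 g2]; split.
- have -> : (fun x => Re (a * f x + g x)) =
    (fun x => (Re a * Re (f x) + (- Im a) * Im (f x)) + Re (g x)).
    by apply/funext => x; rewrite ReD ReM mulNr.
  by do ?apply: locally_integrableD => //; apply: (Z).
- have -> : (fun x => Im (a * f x + g x)) =
    (fun x => (Re a * Im (f x) + Im a * Re (f x)) + Im (g x)).
    by apply/funext => x; rewrite ImD ImM.
  by do ?apply: locally_integrableD => //; apply: (Z).
Qed.

Lemma L2_loc_integrable f : L2 f -> loc_integrable f.
Proof.
move=> [f1 f2 f3].
have key (u : R -> R) : measurable_fun halfline u ->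
    (forall x, `|u x| <= 1 + (Re (f x) ^+ 2 + Im (f x) ^+ 2)) ->
    locally_integrable halfline u.
  move=> mu_ ule; split; [by []|exact: halfline_open|].
  move=> K KD cK.
  have mD := halfline_measurable.
  have mK : @measurable _ (measurableTypeR R) K by exact: compact_measurable.
  have msq : measurable_fun halfline (fun x => Re (f x) ^+ 2 + Im (f x) ^+ 2).
    by apply: measurable_funD; apply: measurable_funX.
  have i1 : mu.-integrable K (EFin \o (fun x => Re (f x) ^+ 2 + Im (f x) ^+ 2)).
    apply: (integrableS mD mK KD); apply/integrableP; split.
      exact/measurable_EFinP.
    apply: le_lt_trans f3; rewrite le_eqVlt; apply/orP; left; apply/eqP.
    by apply: eq_integral => x _; rewrite /= ger0_norm// addr_ge0// sqr_ge0.
  have i2 : mu.-integrable K (EFin \o (cst 1 : R -> R)).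
    apply: continuous_compact_integrable => //.
    by apply: continuous_subspaceT => x; exact: cst_continuous.
  suff : mu.-integrable K (EFin \o u) by move=> /integrableP[].
  apply: le_integrable (integrableD mK i2 i1) => //.
    by apply/measurable_EFinP; apply: measurable_funS mu_.
  move=> x _ /=; rewrite lee_fin (le_trans (ule x))//.
  exact: ler_norm.
have sq (y : R) : `|y| <= 1 + y ^+ 2.
  rewrite -(real_normK (num_real y)).
  have := sqr_ge0 (`|y| - 1); have := normr_ge0 y; nra.
split; apply: key => // x; apply: le_trans (sq _) _.
- by rewrite lerD2l lerDl sqr_ge0.
- by rewrite lerD2l lerDr sqr_ge0.
Qed.

Lemma derive1n_support (a b : R) phi (k : nat) :
  (forall x, x \notin `[a, b] -> phi x = 0) ->
  forall x, x \notin `[a, b] -> derive1n k phi x = 0.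
Proof.
move=> phi0; elim: k => // k IH x xab.
rewrite /derive1n iterS derive1E -/(derive1n k phi).
have -> : 'D_1 (derive1n k phi) x = 'D_1 (cst 0) x; last exact: derive_cst.
apply: near_eq_derive.
have oC : open (~` (`[a, b] : set R)) by apply: closed_openC; exact: interval_closed.
have : nbhs x (~` (`[a, b] : set R)).
  by apply: open_nbhs_nbhs; split => //=; exact/negP.
by apply: filterS => y /= /negP; exact: IH.
Qed.

Lemma test_cintegrable phi (k : nat) f : test_function phi ->
  loc_integrable f -> cintegrable (fun x => (derive1n k phi x)%:C * f x).
Proof.
move=> [dphi [a [b [a0 phi0]]]] [f1 f2].
have mD := halfline_measurable.
have mab : @measurable _ (measurableTypeR R) `[a, b] by exact: measurable_itv.
have abD : `[a, b] `<=` halfline.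
  by move=> x; rewrite /halfline /= !in_itv/= andbT => /andP[ax _]; exact: lt_le_trans ax.
have cphi : continuous (derive1n k phi).
  by move=> x; apply: differentiable_continuous; apply/derivable1_diffP.
have key (u : R -> R) : locally_integrable halfline u ->
    mu.-integrable halfline (EFin \o (fun x => derive1n k phi x * u x)).
  move=> [mu_ _ iu].
  have -> : EFin \o (fun x => derive1n k phi x * u x) =
      (EFin \o (fun x => derive1n k phi x * u x)) \_ (`[a, b]%classic).
    apply/funext => x /=; rewrite patchE; case: ifPn => // xab.
    rewrite (derive1n_support k phi0) ?mul0r//.
    by apply: contra xab => xab; rewrite inE.
  apply/integrable_restrict => //.
  have -> : halfline `&` `[a, b] = `[a, b]%classic by exact/setIidPr.
  have iab : mu.-integrable `[a, b]%classic (EFin \o u).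
    apply/integrableP; split.
      by apply/measurable_EFinP; apply: measurable_funS mu_.
    by apply: iu => //; exact: segment_compact.
  have bphi : [bounded derive1n k phi x | x in `[a, b]%classic].
    suff : bounded_set (derive1n k phi @` `[a, b]%classic).
      move=> [M [Mr MP]]; exists M; split => // N MN x xab.
      by apply: MP MN _ _; exists x.
    apply: compact_bounded; apply: continuous_compact.
      exact: continuous_subspaceT.
    exact: segment_compact.
  have mphi : @measurable_fun _ _ (measurableTypeR R) _ `[a, b]%classic (derive1n k phi).
    by apply: measurable_funTS; exact: continuous_measurable_fun.
  have := integrableMr mab mphi bphi iab.
  by apply: eq_integrable => // x _; rewrite /= EFinM.
split.
- have -> : (fun x => (Re ((derive1n k phi x)%:C * f x))%:E) =
      EFin \o (fun x => derive1n k phi x * Re (f x)).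
    by apply/funext => x /=; rewrite ReM /= mul0r subr0.
  exact: key.
- have -> : (fun x => (Im ((derive1n k phi x)%:C * f x))%:E) =
      EFin \o (fun x => derive1n k phi x * Im (f x)).
    by apply/funext => x /=; rewrite ImM /= mul0r addr0.
  exact: key.
Qed.

Lemma distr_deriv_lin (k : nat) (a : R[i]) f g f' g' :
  loc_integrable f -> loc_integrable g -> loc_integrable f' ->
  loc_integrable g' -> distr_deriv k f f' -> distr_deriv k g g' ->
  distr_deriv k (fun x => a * f x + g x) (fun x => a * f' x + g' x).
Proof.
move=> lf lg lf' lg' ff' gg' phi tphi.
have E (psi : R -> R) (u v : R -> R[i]) :
    (fun x => (psi x)%:C * (a * u x + v x)) =
    (fun x => a * ((psi x)%:C * u x) + (psi x)%:C * v x).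
  by apply/funext => x; rewrite mulrDr mulrCA.
rewrite !E.
have [_ ->] := cintegrable_lin a (test_cintegrable k tphi lf)
  (test_cintegrable k tphi lg).
have [_ ->] := cintegrable_lin a (test_cintegrable 0 tphi lf')
  (test_cintegrable 0 tphi lg').
by rewrite (ff' _ tphi) (gg' _ tphi) mulrDr mulrCA.
Qed.

Lemma Hdot_lin (k : nat) (a : R[i]) f g : Hdot k f -> Hdot k g ->
  Hdot k (fun x => a * f x + g x).
Proof.
move=> [lf [f' Lf' ff']] [lg [g' Lg' gg']].
split; first exact: loc_integrable_lin.
exists (fun x => a * f' x + g' x); first exact: L2_lin.
by apply: distr_deriv_lin => //; exact: L2_loc_integrable.
Qed.

Lemma has_trace_lin (a : R[i]) f g (c d : R[i]) :
  has_trace f c -> has_trace g d ->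
  has_trace (fun x => a * f x + g x) (a * c + d).
Proof.
move=> [f' [ff' cf f'c f'c']] [g' [gg' cg g'd g'd']].
have E1 : (fun x => Re (a * f' x + g' x)) =
    (fun x => (Re a * Re (f' x) - Im a * Im (f' x)) + Re (g' x)).
  by apply/funext => x; rewrite ReD ReM.
have E2 : (fun x => Im (a * f' x + g' x)) =
    (fun x => (Re a * Im (f' x) + Im a * Re (f' x)) + Im (g' x)).
  by apply/funext => x; rewrite ImD ImM.
exists (fun x => a * f' x + g' x); split.
- by apply: filterS2 ff' gg' => x ff' gg' Dx; rewrite ff'// gg'.
- move=> x Dx; have [cf1 cf2] := cf x Dx; have [cg1 cg2] := cg x Dx.
  rewrite E1 E2; split.
  + by apply: cvgD => //; apply: cvgB; apply: cvgMl_tmp.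
  + by apply: cvgD => //; apply: cvgD; apply: cvgMl_tmp.
- rewrite E1 ReD ReM.
  by apply: cvgD => //; apply: cvgB; apply: cvgMl_tmp.
- rewrite E2 ImD ImM.
  by apply: cvgD => //; apply: cvgD; apply: cvgMl_tmp.
Qed.

End HalfLine.

Section StarGraph.
Variables (R : realType) (N : nat).
Local Notation mu := (@lebesgue_measure R).

Definition graph_fun : Type := 'I_N -> R -> R[i].
HB.instance Definition _ := GRing.Lmodule.on graph_fun.

Implicit Types (u v : graph_fun).

Definition continuous_at0 u := exists c : R[i], forall j, has_trace (u j) c.

Definition in_H1dot u := (forall j, Hdot 1 (u j)) /\ continuous_at0 u.

Definition in_H1 u := (forall j, Hsob 1 (u j)) /\ continuous_at0 u.

Definition in_L2 u := forall j, L2 (u j).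

Definition H1dot_pred : pred graph_fun := fun u => `[< in_H1dot u >].

Definition L2_pred : pred graph_fun := fun u => `[< in_L2 u >].

Lemma L2_0 : L2 (fun=> 0 : R[i]).
Proof.
split; [exact: measurable_cst|exact: measurable_cst|].
under eq_integral do rewrite /= expr0n /= addr0.
by rewrite integral0.
Qed.

Lemma Hdot_0 (k : nat) : Hdot k (fun=> 0 : R[i]).
Proof.
split; first exact: L2_loc_integrable L2_0.
exists (fun=> 0); first exact: L2_0.
move=> phi _; under [in LHS]eq_fun do rewrite mulr0.
under [in RHS]eq_fun do rewrite mulr0.
have -> : cintegral (fun=> 0 : R[i]) = 0.
  by rewrite /cintegral /Rintegral /= !integral0.
by rewrite mulr0.
Qed.

Lemma has_trace_0 : has_trace (fun=> 0 : R[i]) 0.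
Proof.
exists (fun=> 0); split; first exact: ae_eq_refl.
- by move=> x _; split; exact: cvg_cst.
- exact: cvg_cst.
- exact: cvg_cst.
Qed.

Lemma H1dot_closed : submod_closed H1dot_pred.
Proof.
split=> [|a u v /asboolP[Hu [c uc]] /asboolP[Hv [d vd]]]; apply/asboolP; split.
- by move=> j; exact: Hdot_0.
- by exists 0 => j; exact: has_trace_0.
- by move=> j; exact: Hdot_lin.
- by exists (a * c + d) => j; exact: has_trace_lin.
Qed.

Lemma L2_closed : submod_closed L2_pred.
Proof.
split=> [|a u v /asboolP Hu /asboolP Hv]; apply/asboolP => j.
- exact: L2_0.
- exact: L2_lin.
Qed.

HB.instance Definition _ :=
  GRing.isSubmodClosed.Build R[i] graph_fun H1dot_pred H1dot_closed.
HB.instance Definition _ :=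
  GRing.isSubmodClosed.Build R[i] graph_fun L2_pred L2_closed.

Record H1dot_fun := H1dotFun
  { H1dot_val :> graph_fun; H1dot_valP : H1dot_val \in H1dot_pred }.
HB.instance Definition _ := [isSub for H1dot_val].
HB.instance Definition _ := [Choice of H1dot_fun by <:].
HB.instance Definition _ := [SubChoice_isSubLmodule of H1dot_fun by <:].

Record L2_fun := L2Fun
  { L2_val :> graph_fun; L2_valP : L2_val \in L2_pred }.
HB.instance Definition _ := [isSub for L2_val].
HB.instance Definition _ := [Choice of L2_fun by <:].
HB.instance Definition _ := [SubChoice_isSubLmodule of L2_fun by <:].

Definition constant_pred : pred H1dot_fun :=
  fun u : H1dot_fun =>
    `[< exists c : R[i], forall j, ae_eq mu (@halfline R) (H1dot_val u j) (cst c) >].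

Definition null_pred : pred L2_fun :=
  fun v : L2_fun => `[< forall j, ae_eq mu (@halfline R) (L2_val v j) (cst 0) >].

Lemma graph_fun_linE (a : R[i]) u v j x :
  (a *: u + v) j x = a * u j x + v j x.
Proof. by []. Qed.

Lemma constant_closed : submod_closed constant_pred.
Proof.
split=> [|a u v /asboolP[c uc] /asboolP[d vd]]; apply/asboolP.
  by exists 0 => j; exact: ae_eq_refl.
exists (a * c + d) => j.
have -> : H1dot_val (a *: u + v) = a *: H1dot_val u + H1dot_val v by [].
apply: filterS2 (uc j) (vd j) => x ux vx Dx.
by rewrite graph_fun_linE ux// vx.
Qed.

Lemma null_closed : submod_closed null_pred.
Proof.
split=> [|a u v /asboolP u0 /asboolP v0]; apply/asboolP => j.
  exact: ae_eq_refl.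
have -> : L2_val (a *: u + v) = a *: L2_val u + L2_val v by [].
apply: filterS2 (u0 j) (v0 j) => x ux vx Dx.
by rewrite graph_fun_linE ux// vx//= mulr0 addr0.
Qed.

Definition H1tilde : Type := lmod_quot constant_closed.
HB.instance Definition _ := GRing.Lmodule.on H1tilde.
HB.instance Definition _ := EqQuotient.on H1tilde.

Definition L2space : Type := lmod_quot null_closed.
HB.instance Definition _ := GRing.Lmodule.on L2space.
HB.instance Definition _ := EqQuotient.on L2space.

(* Meaningful for functions of the space only: [insubd] returns 0 otherwise. *)
Definition H1tilde_class u : H1tilde := \pi_(H1tilde) (insubd (0 : H1dot_fun) u).
Definition L2_class v : L2space := \pi_(L2space) (insubd (0 : L2_fun) v).

Definition graph_deriv (k : nat) u : graph_fun := fun j => dderiv k (u j).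

Definition L2_form u v : R[i] :=
  \sum_(j < N) cintegral (fun x => u j x * (v j x)^*%C).

Definition energy_space : Type := (H1tilde * L2space)%type.
HB.instance Definition _ := GRing.Lmodule.on energy_space.

Definition energy_ip (U V : energy_space) : R[i] :=
  L2_form (graph_deriv 1 (repr U.1)) (graph_deriv 1 (repr V.1)) +
  L2_form (repr U.2) (repr V.2).

Definition wave_dom (alpha : R[i]) : set energy_space := [set U |
  exists u v : graph_fun,
  [/\ in_H1dot u /\ (forall j, Hdot 2 (u j)),
      in_H1 v,
      U = (H1tilde_class u, L2_class v)
    & exists (d : 'I_N -> R[i]) (c : R[i]),
      [/\ forall j, has_trace (dderiv 1 (u j)) (d j),
          forall j, has_trace (v j) c
        & \sum_(j < N) d j + alpha * c = 0]]].

Definition wave_act (U : energy_space) : energy_space :=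
  (H1tilde_class (repr U.2), L2_class (graph_deriv 2 (repr U.1))).

Definition wave_op (alpha : R[i]) : unbounded_op energy_space :=
  UnboundedOp (wave_dom alpha) wave_act.

End StarGraph.

(* Main.v *)
Require Import Defs.
From mathcomp Require Import all_boot all_order all_algebra.
From mathcomp Require Import all_classical all_reals all_analysis.
From mathcomp Require Import complex generic_quotient.
From mathcomp Require Import measurable_realfun ring lra.

(* Green's formula on each edge gives Re <W U, U> = Re(alpha) |v(0)|^2, hence
   the sign statements. For s = 1 or s = -1 with s Re(alpha) <= 0, expanding
   the square shows that |(W - s) U| >= |U|, so that s is in the resolvent set
   as soon as W - s is onto. To solve (W - s)(u, v) = (f, g), write w = u': then
   v' = s w + f' and w' = s v + g, and p = w + s v, q = w - s v satisfy
   p' = p + (g + s f') and q' = - q + (g - s f'). Each equation has L^2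
   solutions: a unique one for p, one for each value at 0 for q. The vertex
   conditions then amount to (N s - alpha) v(0) = sum_j p_j(0), where
   N s - alpha <> 0. When Re(alpha) = 0 both W - 1 and W + 1 are onto, which
   makes the skew-symmetric W skew-adjoint.

   Everything rests on identifying the functions with a weak derivative g with
   the primitives c + \int_0^x g, which satisfy the product rule by Fubini. *)

Set Implicit Arguments.
Unset Strict Implicit.
Unset Printing Implicit Defensive.

Import Order.TTheory GRing.Theory Num.Theory.
Import numFieldNormedType.Exports.

Local Open Scope classical_set_scope.
Local Open Scope quotient_scope.
Local Open Scope ring_scope.
Local Open Scope complex_scope.

Local Notation Re := (@complex.Re _).
Local Notation Im := (@complex.Im _).

(** * Primitives and the product rule *)

(** Test functions have compact support in the open half-line, so weak derivatives alone say nothing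
    at the vertex. Traces are read off primitives started at 0, and the passage to primitives needs
    that a function with zero weak derivative is constant. This is obtained by testing against
    differences of two smooth steps, whose derivatives are mollifiers near two points; hence the
    construction of smooth functions from exp(-1/x). The values s = 1 and s = -1 are taken because
    s^2 = 1: this decouples the system with coefficients 1 and -1, and leaves exactly |U|^2 in the
    expanded square. N s - alpha is nonzero since s (N s - alpha) has real part N - Re(s alpha) > 0.
    The backward equation dictates each p_j(0), the forward one leaves each q_j(0) free; continuity
    at the vertex spends this freedom up to the single unknown v(0). A second obstacle is that the
    inner product and the operator are defined on classes, through chosen representatives and chosen
    weak derivatives. Computations are made on tuples of functions, and shown not to depend on these
    choices. *)

Section RealIntegrable.
Variable R : realType.
Local Notation mu := (@lebesgue_measure R).
Local Notation D := (@halfline R).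
Implicit Types (f g h : R -> R) (A B : set R).
Local Notation "A .-int f" := (mu.-integrable A (EFin \o f))
  (at level 2, format "A .-int  f").

Lemma eq_integrableR A f g : (@measurable _ (measurableTypeR R) A) ->
  (forall x, A x -> f x = g x) -> A.-int f -> A.-int g.
Proof.
move=> mA fg; apply: eq_integrable => // x /set_mem Ax /=.
by rewrite fg.
Qed.

Lemma integrableRZ A c f : (@measurable _ (measurableTypeR R) A) -> A.-int f ->
  A.-int (fun x => c * f x).
Proof.
by move=> mA fi; have := integrableZl mA c fi; exact: eq_integrable.
Qed.

Lemma integrableRD A f g : (@measurable _ (measurableTypeR R) A) -> A.-int f ->
  A.-int g -> A.-int (fun x => f x + g x).
Proof.
by move=> mA fi gi; have := integrableD mA fi gi; exact: eq_integrable.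
Qed.

Lemma integrableRN A f : (@measurable _ (measurableTypeR R) A) -> A.-int f ->
  A.-int (fun x => - f x).
Proof.
move=> mA /(integrableRZ (-1) mA); apply: eq_integrableR => // x _; by rewrite mulN1r.
Qed.

Lemma integrableRB A f g : (@measurable _ (measurableTypeR R) A) -> A.-int f ->
  A.-int g -> A.-int (fun x => f x - g x).
Proof. by move=> mA fi gi; apply: integrableRD => //; exact: integrableRN. Qed.

Lemma integrableR_measurable A f : A.-int f -> measurable_fun A f.
Proof. by move=> /integrableP[/measurable_EFinP]. Qed.

Lemma le_integrableR A f g : (@measurable _ (measurableTypeR R) A) ->
  measurable_fun A f -> (forall x, A x -> `|f x| <= g x) -> A.-int g ->
  A.-int f.
Proof.
move=> mA mf fg; apply: le_integrable => //; first exact/measurable_EFinP.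
move=> x Ax /=; rewrite lee_fin (le_trans (fg _ Ax))//; exact: ler_norm.
Qed.

Lemma integrableR_bounded_mul A f g M : (@measurable _ (measurableTypeR R) A) ->
  measurable_fun A f -> (forall x, A x -> `|f x| <= M) -> A.-int g ->
  A.-int (fun x => f x * g x).
Proof.
move=> mA mf fM gi.
apply: (@le_integrableR _ _ (fun x => M * `|g x|)) => //.
- by apply: measurable_funM => //; exact: integrableR_measurable.
- by move=> x Ax; rewrite normrM ler_wpM2r// fM.
- by apply: integrableRZ => //; exact: integrable_norm.
Qed.

Lemma integrableR_restrict A B f : (@measurable _ (measurableTypeR R) A) ->
  (@measurable _ (measurableTypeR R) B) ->
  A.-int (f \_ B) <-> (A `&` B).-int f.
Proof.
by move=> mA mB; rewrite -restrict_EFin; split => /integrable_restrict; exact.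
Qed.

Lemma measurable_itvR (i : interval R) : @measurable _ (measurableTypeR R) [set` i].
Proof. exact: measurable_itv. Qed.

(** Integrability reaches the endpoint 0, unlike [locally_integrable] on the open half-line; this is
    what gives primitives started at 0 a meaning. *)
Definition intloc f := forall b : R, `]0, b].-int f.

Lemma intloc_lin c f g : intloc f -> intloc g ->
  intloc (fun x => c * f x + g x).
Proof. by move=> fi gi b; apply: integrableRD => //; exact: integrableRZ. Qed.

Lemma continuous_intloc f : continuous f -> intloc f.
Proof.
move=> cf b; apply: (@integrableS _ _ _ mu `[0, b]) => //.
  exact: subset_itv_oc_cc.
apply: continuous_compact_integrable; first exact: segment_compact.
exact: continuous_subspaceT.
Qed.

(** For x <= 0 the interval is empty and the value is [c], so a primitive is continuous on the whole
    line and its trace at 0 is [c]. *)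
Definition prim c f (x : R) : R := c + \int[mu]_(t in `]0, x]) f t.

Lemma prim_le0 c f x : x <= 0 -> prim c f x = c.
Proof.
by move=> x0; rewrite /prim set_itv_ge ?Rintegral_set0 ?addr0// bnd_simp -leNgt.
Qed.

Lemma prim_diff c f a b : intloc f -> 0 <= a -> a <= b ->
  prim c f b - prim c f a = \int[mu]_(t in `]a, b]) f t.
Proof.
move=> fi a0 ab; rewrite /prim opprD addrACA subrr add0r.
by rewrite Rintegral_itvB.
Qed.

Lemma prim_lin k c d f g x : intloc f -> intloc g ->
  k * prim c f x + prim d g x =
  prim (k * c + d) (fun x => k * f x + g x) x.
Proof.
move=> fi gi; rewrite /prim RintegralD//; last exact: integrableRZ.
by rewrite RintegralZl// mulrDr addrACA.
Qed.

Lemma eq_prim c f g x : (forall t, 0 < t -> f t = g t) ->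
  prim c f x = prim c g x.
Proof.
move=> fg; rewrite /prim; congr (_ + _); apply: eq_Rintegral => t.
by rewrite inE/= in_itv/= => /andP[t0 _]; exact: fg.
Qed.

Lemma prim_continuous c f : intloc f -> continuous (prim c f).
Proof.
move=> fi x.
have [x0|x0] := ltP x 0.
  have H : \forall y \near x, cst c y = prim c f y.
    near=> y; rewrite prim_le0//; apply: ltW; near: y.
    exact: lt_nbhsl.
  apply: (cvg_trans (near_eq_cvg H)); rewrite prim_le0 ?(ltW x0)//.
  exact: cvg_cst.
(* Extending [f] by 0 and integrating from -1 puts x, even x = 0, in the interior of [-1, b], where
   continuity of the parameterized integral applies. *)
pose b := x + 1; pose g := f \_ `]0, b].
have b0 : 0 < b by rewrite /b ltr_wpDl.
have gi : `[-1, b].-int g.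
  apply/integrableR_restrict => //; rewrite setIidr//.
  by apply: subset_itvScc; rewrite bnd_simp.
have Nb : -1 < b by rewrite (lt_trans _ b0)// oppr_lt0.
have := parameterized_integral_continuous (ltW Nb) gi.
move=> /(continuous_within_itvP _ Nb)[+ _ _] => /(_ x).
rewrite in_itv/= (lt_le_trans _ x0) ?oppr_lt0//= /b ltrDl ltr01 => /(_ isT).
have E y : y < b -> parameterized_integral mu (-1) y g = prim 0 f y.
  move=> yb; rewrite /prim add0r /parameterized_integral /g.
  rewrite -Rintegral_mkcondr; congr (Rintegral _ _ _).
  apply/seteqP; split => z; rewrite /= !in_itv/=.
    by move=> [/andP[_ ->] /andP[-> _]].
  move=> /andP[z0 zy]; rewrite z0 zy (le_trans zy (ltW yb)) andbT; split => //.
  by rewrite (le_trans _ (ltW z0))// oppr_le0.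
move=> H0; have H1 := @cvgD _ _ _ _ _ (cst c) _ _ _ (cvg_cst c) H0.
have Ex : prim c f x = c + parameterized_integral mu (-1) x g.
  by rewrite E ?/b ?ltrDl// /prim add0r.
have H2 : \forall y \near x,
    c + parameterized_integral mu (-1) y g = prim c f y.
  near=> y; rewrite E; first by rewrite /prim add0r.
  by near: y; apply: lt_nbhsl; rewrite ltrDl.
rewrite /continuous_at Ex; apply: (cvg_trans (near_eq_cvg H2)).
exact: H1.
Unshelve. all: by end_near. Qed.

Lemma continuous_bounded_itv f (a b : R) : continuous f ->
  exists M, forall x, `[a, b]%classic x -> `|f x| <= M.
Proof.
move=> cf.
have : bounded_set (f @` `[a, b]%classic).
  apply: compact_bounded; apply: continuous_compact.
    exact: continuous_subspaceT.
  exact: segment_compact.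
move=> [M [Mr MP]]; exists (M + 1) => x xab.
by apply: (MP (M + 1)); [rewrite ltrDl|exists x].
Qed.

Lemma intlocM f g : continuous f -> intloc g -> intloc (fun x => f x * g x).
Proof.
move=> cf gi b.
have [M MP] := @continuous_bounded_itv f 0 b cf.
apply: (@integrableR_bounded_mul _ _ _ M) => //.
- by apply: measurable_funTS; exact: continuous_measurable_fun.
- by move=> x /subset_itv_oc_cc; exact: MP.
Qed.

Lemma EFin_Rintegral A f : (@measurable _ (measurableTypeR R) A) -> A.-int f ->
  (\int[mu]_(x in A) (f x)%:E)%E = (\int[mu]_(x in A) f x)%:E.
Proof. by move=> mA fi; rewrite /Rintegral fineK//; exact: integrable_fin_num. Qed.

Lemma prim_cst0 f x : prim 0 f x = \int[mu]_(t in `]0, x]) f t.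
Proof. by rewrite /prim add0r. Qed.

Lemma integralZ_patch A c f : (@measurable _ (measurableTypeR R) A) -> A.-int f ->
  (\int[mu]_x (c * (f \_ A) x)%:E)%E = (c * \int[mu]_(x in A) f x)%:E.
Proof.
move=> mA fi; have fAi : setT.-int (f \_ A).
  by apply/integrableR_restrict => //; rewrite setTI.
rewrite EFin_Rintegral//; last exact: integrableRZ.
by rewrite RintegralZl// [in RHS]Rintegral_mkcond.
Qed.

(** Fubini for f(x) g(y) on the triangle 0 < y <= x <= b: the left side integrates in y first, the
    right side in x first. *)
Lemma prim_triangle f g b : intloc f -> intloc g ->
  \int[mu]_(x in `]0, b]) (f x * prim 0 g x) =
  \int[mu]_(y in `]0, b]) (g y * (prim 0 f b - prim 0 f y)).
Proof.
move=> fi gi; set I := `]0, b]%classic.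
have mI : @measurable _ (measurableTypeR R) I by exact: measurable_itv.
pose f1 := f \_ I; pose g1 := g \_ I.
have f1i : setT.-int f1 by apply/integrableR_restrict => //; rewrite setTI; exact: fi.
have g1i : setT.-int g1 by apply/integrableR_restrict => //; rewrite setTI; exact: gi.
pose T := [set z : measurableTypeR R * measurableTypeR R | z.2 <= z.1].
pose F (z : measurableTypeR R * measurableTypeR R) : R :=
  f1 z.1 * g1 z.2 * \1_T z.
have mT : measurable T.
  rewrite -[T]setTI; apply: measurable_fun_le => //.
have mF : measurable_fun setT F.
  apply: measurable_funM; last exact: measurable_indic.
  apply: measurable_funM.
    by apply: measurableT_comp measurable_fst; exact: integrableR_measurable.
  by apply: measurableT_comp measurable_snd; exact: integrableR_measurable.
(* Tonelli: the integral of |F(x, y)| in y is at most |f1(x)| times the integral of |g1|. *)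
have iF : (mu \x mu)%E.-integrable setT (EFin \o F).
  apply/integrable12ltyP; first exact/measurable_EFinP.
  pose M := (\int[mu]_y `|g1 y|)%R.
  have Mi : setT.-int (fun x => `|f1 x| * M).
    apply: (@eq_integrableR _ (fun x => M * `|f1 x|)) => //.
      by move=> x _; rewrite mulrC.
    by apply: integrableRZ => //; exact: integrable_norm.
  move: Mi => /integrableP[_]; apply: le_lt_trans.
  apply: ge0_le_integral => //.
  - by move=> x _; exact: integral_ge0.
  - apply: (@measurable_fun_fubini_tonelli_F _ _ _ _ _ mu 
      (fun z => `|(F z)%:E|%E)) => //.
    by apply: measurableT_comp => //; exact/measurable_EFinP.
  - apply/measurable_EFinP; apply: measurableT_comp => //.
    apply: measurable_funM => //; apply: measurableT_comp => //.
    exact: integrableR_measurable.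
  move=> x _ /=.
  rewrite ger0_norm ?mulr_ge0//; last exact: Rintegral_ge0.
  rewrite EFinM -EFin_Rintegral//; last exact: integrable_norm.
  rewrite -ge0_integralZl//; last first.
    apply/measurable_EFinP; apply: measurableT_comp => //.
    exact: integrableR_measurable.
  apply: ge0_le_integral => //.
  - apply/measurable_EFinP; apply: measurableT_comp => //.
    exact: (measurableT_comp mF (measurable_pair1 x)).
  - apply/measurable_EFinP; apply: measurable_funM => //.
    by apply: measurableT_comp => //; exact: integrableR_measurable.
  move=> y _; rewrite -EFinM lee_fin /F/= !normrM.
  rewrite ler_piMr// ?mulr_ge0// indicE.
  by case: (_ \in _); rewrite ?normr1 ?normr0.
have := Fubini iF.
have -> : (\int[mu]_x \int[mu]_y (EFin \o F) (x, y) =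
    (\int[mu]_(x in I) (f x * prim 0 g x))%:E)%E.
  rewrite -EFin_Rintegral//; last first.
    apply: (@eq_integrableR _ (fun x => prim 0 g x * f x)) => //.
      by move=> x _; rewrite mulrC.
    by apply: intlocM => //; exact: prim_continuous.
  rewrite [RHS]integral_mkcond; apply: eq_integral => x _.
  rewrite patchE; case: ifPn => xI; last first.
    by apply: integral0_eq => y _; rewrite /= /F /= /f1 patchE (negbTE xI) !mul0r.
  have xI' := set_mem xI; move: (xI'); rewrite /I/= in_itv/= => /andP[x0 xb].
  rewrite prim_cst0 -integralZ_patch//.
  apply: eq_integral => y _ /=; congr EFin.
  rewrite /F /= /f1 patchE xI -mulrA; congr (_ * _).
  rewrite /g1 !patchE indicE.
  have [y0|y0] := ltP 0 y; last first.
    have yJ (c' : R) : (y \in `]0, c']%classic) = false.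
      by rewrite memNset//= in_itv/= ltNge y0.
    by rewrite /I !yJ mul0r.
  have [yx|yx] := leP y x; last first.
    rewrite [(x, y) \in T]memNset ?mulr0; last by rewrite /T/= leNgt yx.
    by rewrite [in RHS]memNset//= in_itv/= y0 leNgt yx.
  rewrite [(x, y) \in T]mem_set// mulr1.
  by rewrite !mem_set ?/I//= in_itv/= y0 ?yx ?(le_trans yx).
have -> : (\int[mu]_y \int[mu]_x (EFin \o F) (x, y) =
    (\int[mu]_(y in I) (g y * (prim 0 f b - prim 0 f y)))%:E)%E.
  rewrite -EFin_Rintegral//; last first.
    apply: (@eq_integrableR _ (fun x => prim 0 f b * g x - prim 0 f x * g x)) => //.
      by move=> x _; rewrite mulrBr ![g x * _]mulrC.
    apply: integrableRB => //; first exact: integrableRZ (gi b).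
    by apply: intlocM => //; exact: prim_continuous.
  rewrite [RHS]integral_mkcond; apply: eq_integral => y _.
  rewrite patchE; case: ifPn => yI; last first.
    apply: integral0_eq => x _; rewrite /= /F /= /g1 patchE (negbTE yI).
    by rewrite mulr0 mul0r.
  have yI' := set_mem yI; move: (yI'); rewrite /I/= in_itv/= => /andP[y0 yb].
  have iyb : `[y, b].-int f.
    apply: integrableS (fi b) => //.
    by move=> z; rewrite /= !in_itv/= => /andP[yz ->]; rewrite (lt_le_trans y0).
  rewrite prim_diff// ?(ltW y0)//.
  have iyb' : `]y, b].-int f.
    by apply: integrableS iyb => //; exact: subset_itv_oc_cc.
  (* The section of the triangle at height y is closed at y, whereas the difference of primitives
     lives on ]y, b]; one point has measure 0. *)
  rewrite Rintegral_itv_obnd_cbnd//.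
  rewrite -integralZ_patch//.
  apply: eq_integral => x _ /=; congr EFin.
  rewrite /F /= /g1 patchE yI mulrAC mulrC; congr (_ * _).
  rewrite /f1 !patchE indicE.
  have [yx|yx] := leP y x; last first.
    rewrite [(x, y) \in T]memNset ?mulr0; last by rewrite /T/= leNgt yx.
    by rewrite [in RHS]memNset//= in_itv/= leNgt yx.
  rewrite [(x, y) \in T]mem_set// mulr1.
  have [xb|xb] := leP x b.
    by rewrite !mem_set ?/I//= in_itv/= ?yx ?xb// (lt_le_trans y0).
  by rewrite !memNset ?/I//= in_itv/= => /andP[_]; rewrite leNgt xb.
by move=> [].
Qed.

(** After [prim_triangle] the two terms in F g cancel, F being the primitive of f, and F(b) times
    the integral of g remains. *)
Lemma primM0 f g b : intloc f -> intloc g ->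
  prim 0 (fun x => f x * prim 0 g x + prim 0 f x * g x) b =
  prim 0 f b * prim 0 g b.
Proof.
move=> fi gi; have cg := @prim_continuous 0 _ gi.
have cf := @prim_continuous 0 _ fi.
rewrite [LHS]prim_cst0 RintegralD//; first last.
- exact: intlocM.
- apply: (@eq_integrableR _ (fun x => prim 0 g x * f x)) => //.
    by move=> x _; rewrite mulrC.
  exact: intlocM.
rewrite prim_triangle//.
rewrite -RintegralD//; first last.
- exact: intlocM.
- apply: (@eq_integrableR _ (fun x => prim 0 f b * g x - prim 0 f x * g x)) => //.
    by move=> x _; rewrite mulrBr ![g x * _]mulrC.
  by apply: integrableRB => //; [exact: integrableRZ|exact: intlocM].
transitivity (\int[mu]_(x in `]0, b]) (prim 0 f b * g x)).
  by apply: eq_Rintegral => x _; ring.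
by rewrite RintegralZl// -prim_cst0.
Qed.

Lemma primM c d f g b : intloc f -> intloc g ->
  prim (c * d) (fun x => f x * prim d g x + prim c f x * g x) b =
  prim c f b * prim d g b.
Proof.
move=> fi gi.
have E e h x : prim e h x = e + prim 0 h x by rewrite prim_cst0.
have cg := @prim_continuous 0 _ gi.
have cf := @prim_continuous 0 _ fi.
have -> : prim c f b * prim d g b = c * d +
    (c * prim 0 g b + (d * prim 0 f b + prim 0 f b * prim 0 g b)).
  by rewrite (E c) (E d); ring.
rewrite -primM0// (E (c * d)); congr (_ + _).
have i1 : intloc (fun x => f x * prim 0 g x + prim 0 f x * g x).
  move=> e; apply: integrableRD => //; last exact: intlocM.
  apply: (@eq_integrableR _ (fun x => prim 0 g x * f x)) => //.
    by move=> x _; rewrite mulrC.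
  exact: intlocM.
have := @prim_lin d 0 0 _ _ b fi i1; rewrite mulr0 addr0.
have i2 : intloc (fun x => d * f x + (f x * prim 0 g x + prim 0 f x * g x)).
  exact: intloc_lin.
have := @prim_lin c 0 0 _ _ b gi i2; rewrite mulr0 addr0.
move=> + H; rewrite -{}H => ->.
by congr (prim _ _ _); apply/funext => x; rewrite (E c) (E d); ring.
Qed.

End RealIntegrable.

(** * Smooth functions *)

Section Smooth.
Variable R : realType.
Local Notation mu := (@lebesgue_measure R).
Implicit Types (f g : R -> R).

(** The functions x^(-n) exp(-1/x), extended by 0. Their span is stable under differentiation, so
    smoothness at 0 reduces to the existence of first derivatives. *)
Definition flat (n : nat) (x : R) : R :=
  if 0 < x then x^-1 ^+ n * expR (- x^-1) else 0.

(** From exp(y) >= y^(n+2) / (n+2)! at y = 1/x. The power 2 on the right makes the difference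
    quotients at 0 tend to 0. *)
Lemma flat_bound n x : 0 < x -> flat n x <= (n.+2)`!%:R * x ^+ 2.
Proof.
move=> x0; rewrite /flat x0 expRN.
have y0 : 0 <= x^-1 by rewrite invr_ge0 ltW.
have := expR_ge1Dxn n.+1 y0 => H.
rewrite ler_pdivrMr ?expR_gt0//.
have H' : x^-1 ^+ n.+2 / n.+2`!%:R <= expR x^-1.
  by apply: le_trans H; rewrite lerDr.
have F0 : (0 : R) < (n.+2)`!%:R by rewrite ltr0n fact_gt0.
have -> : x^-1 ^+ n = n.+2`!%:R * x ^+ 2 * (x^-1 ^+ n.+2 / n.+2`!%:R).
  rewrite !exprS; field; rewrite gt_eqF//= lt0r_neq0//.
by rewrite ler_wpM2l// mulr_ge0// ?ltW// exprn_gt0.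
Qed.

Lemma flat_ge0 n x : 0 <= flat n x.
Proof.
rewrite /flat; case: ltP => // x0.
by rewrite mulr_ge0 ?expR_ge0// exprn_ge0// invr_ge0 ltW.
Qed.

Lemma flat0_le1 x : flat 0 x <= 1.
Proof.
rewrite /flat; case: ltP => // x0.
by rewrite expr0 mul1r -expR0 ler_expR oppr_le0 invr_ge0 ltW.
Qed.

Lemma flat_derive n (x : R) :
  is_derive x 1 (flat n) (flat n.+2 x - n%:R * flat n.+1 x).
Proof.
have [x0|x0|x0] := ltgtP x 0.
- have H : \forall y \near x, cst 0 y = flat n y.
    near=> y; rewrite /flat ltNge ltW//=; near: y; exact: lt_nbhsl.
  rewrite /flat !ltNge !(ltW x0)/= mulr0 subr0.
  exact: near_eq_is_derive H _.
- have H : \forall y \near x, y^-1 ^+ n * expR (- y^-1) = flat n y.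
    near=> y; rewrite /flat ifT//; near: y; exact: lt_nbhsr.
  apply: near_eq_is_derive H _; rewrite /flat x0.
  have x1 : id x != 0 :> R by rewrite /= gt_eqF.
  have dV := is_deriveV x1 (is_derive_id x 1).
  have d1 := is_deriveX n dV.
  have dN : is_derive x 1 (fun y : R => - y^-1) (x ^- 2).
    have E : - ((- x ^- 2) *: (1 : R)) = x ^- 2 by rewrite /GRing.scale/= mulr1 opprK.
    by rewrite -E; exact: is_deriveN dV.
  have d2 := @is_derive1_comp _ expR (fun y : R => - y^-1) _ _ _
    (is_derive_expR (- x^-1)) dN.
  have -> : (fun y : R => y^-1 ^+ n * expR (- y^-1)) =
      (fun y : R => y^-1) ^+ n * (expR \o (fun y : R => - y^-1)).
    by apply/funext => y; rewrite /GRing.mul/= exprfctE.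
  apply: (is_derive_eq (is_deriveM d1 d2)).
  rewrite /GRing.scale/= mulr1 exprfctE.
  case: n {d1} => [|n].
    by rewrite !mul0r mulr0 subr0 addr0 expr0 mul1r exprVn mulrC.
  rewrite -pred_Sn !exprS !exprVn; field; rewrite x1/=.
  by rewrite expf_neq0.
- rewrite x0 /flat ltxx mulr0 subr0.
  have H : h^-1 *: ((flat n \o shift 0) (h *: 1) - flat n 0) @[h --> 0^'] --> (0 : R).
    apply: (@cvg_to_0_linear _ _ (n.+2)`!%:R 1) => // h /andP[h0 _].
    rewrite /GRing.scale/= addr0 mulr1 {2}/flat ltxx subr0.
    rewrite normrM normfV ler_pdivrMl// mulrCA -expr2 real_normK ?num_real//.
    rewrite ger0_norm ?flat_ge0//; have [h1|h1] := ltP 0 h; first exact: flat_bound.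
    by rewrite /flat ltNge h1/= mulr_ge0 ?sqr_ge0.
  apply: DeriveDef.
    by apply/cvg_ex; exists 0.
  by apply/cvg_lim => //; exact: Rhausdorff.
Unshelve. all: by end_near.
Qed.

(** A class closed under differentiation by construction: one structural induction yields
    derivatives of all orders without a formula for them. The last constructor is there for [step],
    a primitive of [bump]. *)
Inductive smooth : (R -> R) -> Prop :=
| smooth_cst c : smooth (fun=> c)
| smooth_flat n : smooth (flat n)
| smoothD f g : smooth f -> smooth g -> smooth (fun x => f x + g x)
| smoothM f g : smooth f -> smooth g -> smooth (fun x => f x * g x)
| smooth_affine c d f : smooth f -> smooth (fun x => f (c * x + d))
| smooth_primitive f g : (forall x : R, is_derive x 1 f (g x)) -> smooth g ->
    smooth f.

Lemma smooth_derive f : smooth f ->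
  exists2 g, smooth g & forall x : R, is_derive x 1 f (g x).
Proof.
elim=> {f} [c|n|f g fs [f' f's df] gs [g' g's dg]|
  f g fs [f' f's df] gs [g' g's dg]|c d f fs [f' f's df]|f g df gs _].
- by exists (fun=> 0); [exact: smooth_cst|move=> x; exact: is_derive_cst].
- exists (fun x => flat n.+2 x + (- n%:R) * flat n.+1 x).
    apply: smoothD; first exact: smooth_flat.
    by apply: smoothM; [exact: smooth_cst|exact: smooth_flat].
  by move=> x; rewrite mulNr; exact: flat_derive.
- exists (fun x => f' x + g' x); first exact: smoothD.
  by move=> x; exact: is_deriveD.
- exists (fun x => f x * g' x + f' x * g x); first by apply: smoothD; exact: smoothM.
  move=> x; have := is_deriveM (df x) (dg x).
  by move=> H; apply: is_derive_eq H _; rewrite /GRing.scale/= [g x * _]mulrC.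
- exists (fun x => c * f' (c * x + d)).
    by apply: smoothM; [exact: smooth_cst|exact: smooth_affine].
  move=> x.
  have da : is_derive x 1 (fun y : R => c * y + d) c.
    have H : is_derive x 1 ((c \*: @id R) + cst d) (c *: 1 + 0) by exact: is_deriveD.
    by apply: is_derive_eq H _; rewrite /GRing.scale/= mulr1 addr0.
  rewrite mulrC.
  exact: (@is_derive1_comp _ f (fun y : R => c * y + d) _ _ _ (df _) da).
- by exists g.
Qed.

Lemma smooth_derive1 f : smooth f ->
  (forall x : R, derivable f x 1) /\ smooth (fun x => derive1 f x).
Proof.
move=> /smooth_derive[g gs df]; split=> [x|]; first by have [] := df x.
suff -> : (fun x => derive1 f x) = g by [].
by apply/funext => x; rewrite derive1E; have [_] := df x.
Qed.

Lemma smooth_derive1n n f : smooth f -> smooth (fun x => derive1n n f x).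
Proof.
move=> fs; elim: n => // n IH.
by rewrite derive1nS; have [_] := smooth_derive1 IH.
Qed.

Lemma smooth_derivable n f (x : R) : smooth f -> derivable (derive1n n f) x 1.
Proof. by move=> /(smooth_derive1n n)/smooth_derive1[]. Qed.

Lemma is_derive_continuous f g : (forall x : R, is_derive x 1 f (g x)) ->
  continuous f.
Proof.
move=> df x; apply: differentiable_continuous; apply/derivable1_diffP.
by have [] := df x.
Qed.

Lemma smooth_continuous f : smooth f -> continuous f.
Proof. by move=> /smooth_derive[g _]; exact: is_derive_continuous. Qed.

Definition bump (x : R) : R := flat 0 x * flat 0 (1 - x).

Lemma smooth_bump : smooth bump.
Proof.
have -> : bump = fun x => flat 0 x * flat 0 (-1 * x + 1).
  by apply/funext => x; rewrite /bump mulN1r [_ + 1]addrC.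
apply: smoothM; first exact: smooth_flat.
by apply: (@smooth_affine (-1) 1 (flat 0)); exact: smooth_flat.
Qed.

Lemma bump_ge0 x : 0 <= bump x.
Proof. by rewrite mulr_ge0 ?flat_ge0. Qed.

Lemma bump_le1 x : bump x <= 1.
Proof. by rewrite mulr_ile1 ?flat_ge0 ?flat0_le1. Qed.

Lemma bump_gt0 x : 0 < x -> x < 1 -> 0 < bump x.
Proof.
move=> x0 x1; rewrite /bump /flat x0 subr_gt0 x1.
by rewrite !expr0 !mul1r mulr_gt0 ?expR_gt0.
Qed.

Lemma bump_out x : ~ (0 < x < 1) -> bump x = 0.
Proof.
rewrite /bump /flat; case: ltP => x0; last by rewrite mul0r.
by rewrite subr_gt0 /=; case: ltP => // x1; rewrite mulr0.
Qed.

(** A smooth step rising on [0, 1] from 0 to the positive constant [step 1]. It is not normalized,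
    and [step 1] is cancelled at the end of [wderiv0_cst]. *)
Definition step (x : R) : R := \int[mu]_(t in `]-oo, x]) bump t.

Lemma bump_integrable (A : set R) : (@measurable _ (measurableTypeR R) A) ->
  mu.-integrable A (EFin \o bump).
Proof.
move=> mA; have -> : bump = bump \_ `]0, 1].
  apply/funext => x; rewrite patchE; case: ifPn => // /negP xI.
  apply: bump_out => /andP[x0 x1]; apply: xI.
  by rewrite inE/= in_itv/= x0 ltW.
apply/integrableR_restrict => //.
apply: integrableS (continuous_intloc (smooth_continuous smooth_bump) 1) => //.
by apply: measurableI.
Qed.

Lemma step_derive (x : R) : is_derive x 1 step (bump x).
Proof.
have xu : x < x + 1 by rewrite ltrDl.
have [] := @continuous_FTC1 _ bump -oo%O x (x + 1) xu (bump_integrable _) _ _.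
- exact: measurable_itv.
- by rewrite ltNyr.
- exact: smooth_continuous smooth_bump _.
by move=> d1 d2; apply: DeriveDef => //; rewrite -derive1E.
Qed.

Lemma step0 x : x <= 0 -> step x = 0.
Proof.
move=> x0; rewrite /step /Rintegral integral0_eq// => t.
rewrite /= in_itv/= => tx; rewrite bump_out// => /andP[t0 _].
by have := lt_le_trans t0 (le_trans tx x0); rewrite ltxx.
Qed.

Lemma step1 x : 1 <= x -> step x = step 1.
Proof.
move=> x1.
have E y : 1 <= y -> step y = \int[mu]_(t in `]0, 1]) bump t.
  move=> y1; rewrite -[X in Rintegral _ X](@setIidr _ `]-oo, y]%classic); last first.
    by move=> t; rewrite /= !in_itv/= => /andP[_ t1]; exact: le_trans y1.
  rewrite Rintegral_mkcondr; apply: eq_Rintegral => t _.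
  rewrite patchE; case: ifPn => // /negP xI.
  apply: bump_out => /andP[t0 t1]; apply: xI.
  by rewrite inE/= in_itv/= t0 ltW.
by rewrite E// E.
Qed.

Lemma step1_gt0 : 0 < step 1.
Proof.
have cs := is_derive_continuous step_derive.
have [c] := @MVT _ step bump 0 1 ltr01 (fun x _ => step_derive x)
  (continuous_subspaceT cs).
rewrite in_itv/= => /andP[c0 c1]; move=> H.
have {}H : step 1 - step 0 = bump c * (1 - 0) := H.
by rewrite (step0 (lexx 0)) !subr0 mulr1 in H; rewrite H; exact: bump_gt0.
Qed.

Lemma smooth_step : smooth step.
Proof. by apply: smooth_primitive step_derive _; exact: smooth_bump. Qed.

End Smooth.

(** * Weak derivatives *)

Section WeakDerivative.
Variable R : realType.
Local Notation mu := (@lebesgue_measure R).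
Local Notation D := (@halfline R).
Implicit Types (f g h phi : R -> R).

Lemma halflineE (x : R) : D x = (0 < x) :> Prop.
Proof. by rewrite /halfline/= in_itv/= andbT. Qed.

Lemma ae_halfline_exists (Q : R -> Prop) a b : 0 <= a -> a < b ->
  {ae mu, forall x, D x -> Q x} -> exists x, [/\ a < x, x < b & Q x].
Proof.
move=> a0 ab [N [mN N0 NQ]]; apply: contrapT => H.
have : (mu `]a, b[ <= mu N)%E.
  apply: le_measure; rewrite ?inE; [exact: measurable_itvR|exact: mN|].
  move=> x; rewrite /= in_itv/= => /andP[ax xb]; apply: NQ => /= Qx.
  apply: H; exists x; split=> //; apply: Qx.
  by rewrite halflineE (le_lt_trans a0).
by rewrite N0 lebesgue_measure_itv/= lte_fin ab -EFinB lee_fin subr_le0 leNgt ab.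
Qed.

Lemma continuous_ae0 h : (forall x, 0 < x -> {for x, continuous h}) ->
  ae_eq mu D h (cst 0) -> forall x, 0 < x -> h x = 0.
Proof.
move=> ch h0 x x0; apply/eqP; apply/negPn/negP => hx.
have [e /= e0 eP] : \forall y \near x, h y != 0 by exact: cvgr_neq0 (ch _ x0) hx.
have xe : x < x + e by rewrite ltrDl.
have [y [xy yx]] := @ae_halfline_exists (fun y => h y = 0) x (x + e) (ltW x0) xe h0.
move/eqP; apply/negP; apply: eP.
by rewrite /= distrC gtr0_norm ?subr_gt0// ltrBlDl.
Qed.

(** The primitive of f - g started at c - d vanishes almost everywhere, hence on all of ]0, +oo[ by
    continuity. Its limit at 0 gives c = d, and Lebesgue differentiation gives f = g. *)
Lemma prim_ae_inj c d f g : intloc f -> intloc g ->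
  ae_eq mu D (prim c f) (prim d g) -> c = d /\ ae_eq mu D f g.
Proof.
move=> fi gi fg.
pose k x := -1 * g x + f x.
have ki : intloc k by exact: intloc_lin.
have E x : prim (-1 * d + c) k x = - prim d g x + prim c f x.
  by rewrite /k -prim_lin// mulN1r.
have ck := @prim_continuous _ (-1 * d + c) _ ki.
have k0 x : 0 < x -> prim (-1 * d + c) k x = 0.
  apply: continuous_ae0; first by move=> ? _; exact: ck.
  apply: filterS fg => y /= fg Dy; rewrite E fg//; exact: addNr.
have cd : c = d.
  apply/eqP; rewrite -subr_eq0 addrC -mulN1r; apply/eqP.
  rewrite -(@prim_le0 _ (-1 * d + c) k 0)//.
  have H1 := cvg_at_right_filter (ck 0).
  have H2 : prim (-1 * d + c) k y @[y --> 0^'+] --> (0 : R).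
    apply: (@cvg_trans _ (cst (0 : R) @ 0^'+)); last exact: cvg_cst.
    apply: near_eq_cvg; near=> y; rewrite k0//; near: y; exact: nbhs_right_gt.
  exact: (@cvg_unique R (@Rhausdorff R) _ _ _ _ H1 H2).
split=> //.
(* [k] need not be integrable up to infinity, so differentiation is applied to its truncations to
   ]0, n], and countably many null sets are collected. *)
have H n : {ae mu, forall x, 0 < x < n%:R -> k x = 0}.
  pose kn := k \_ `]0, n%:R].
  have kni : mu.-integrable setT (EFin \o kn).
    by apply/integrableR_restrict => //; rewrite setTI; exact: ki.
  have [] := @FTC1 _ kn (BRight 0) _ _.
  - by move=> y; apply: integrableS kni.
  - by apply: open_integrable_locally => //; exact: openT.
  move=> N [mN N0 NP]; exists N; split => // x /= Hx; apply: NP => /= HN.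
  apply: Hx => /andP[x0 xn].
  have x0' : (0%:E < x%:E)%E by rewrite lte_fin.
  have [_] := HN x0'.
  rewrite /kn patchE mem_set/=; last by rewrite in_itv/= x0 ltW.
  move=> <-; rewrite derive1E; apply: derive_val.
  have Hc : \forall y \near x, cst 0 y = \int[mu]_(t in `]0, y]) kn t.
    near=> y.
    have y0 : 0 < y by near: y; exact: lt_nbhsr.
    have yn : y < n%:R by near: y; exact: lt_nbhsl.
    rewrite -Rintegral_mkcondr setIidl; last first.
      by apply: subset_itvl; rewrite bnd_simp ltW.
    by have := k0 _ y0; rewrite /prim cd mulN1r addNr add0r => ->.
  exact: near_eq_is_derive Hc _.
have := ae_foralln H; apply: filterS => x Hx Dx.
move: Dx; rewrite halflineE => x0.
have [n xn] : exists n : nat, x < n%:R by exists (Num.trunc x).+1; exact: truncnS_gt.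
have := Hx n; rewrite x0 xn /k mulN1r => /(_ isT) /eqP.
by rewrite addrC subr_eq0 => /eqP.
Unshelve. all: by end_near. Qed.

Lemma prim_FTC f f' x : (forall y : R, is_derive y 1 f (f' y)) -> continuous f' ->
  0 <= x -> prim (f 0) f' x = f x.
Proof.
rewrite le_eqVlt => df cf' /predU1P[<-|x0]; first by rewrite prim_le0.
have cf := is_derive_continuous df.
have i0x : mu.-integrable `[0, x] (EFin \o f').
  apply: continuous_compact_integrable; first exact: segment_compact.
  exact: continuous_subspaceT.
rewrite /prim Rintegral_itv_obnd_cbnd; last first.
  by apply: integrableS i0x => //; exact: subset_itv_oc_cc.
rewrite /Rintegral (@continuous_FTC2 _ f' f)//.
- by rewrite -EFinB/= addrC subrK.
- exact: continuous_subspaceT.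
- split.
  + by move=> y _; have [] := df y.
  + exact: cvg_at_right_filter (cf 0).
  + exact: cvg_at_left_filter (cf x).
- by move=> y _; rewrite derive1E; apply: derive_val.
Qed.

Lemma test_derive phi (x : R) : test_function phi ->
  is_derive x 1 phi (derive1n 1 phi x).
Proof.
move=> [dphi _]; rewrite derive1n1 derive1E; apply: derivableP; exact: (dphi 0 x).
Qed.

Lemma test_continuous phi n : test_function phi ->
  continuous (fun x => derive1n n phi x).
Proof.
move=> [dphi _] x; apply: differentiable_continuous; apply/derivable1_diffP.
exact: dphi.
Qed.

Lemma test_support phi : test_function phi -> exists2 b, 0 < b &
  phi b = 0 /\ forall n x, ~ (0 < x <= b) -> derive1n n phi x = 0.
Proof.
move=> [_ [a [b [a0 phi0]]]].
have b0 : b < `|b| + 1 by rewrite (le_lt_trans (ler_norm b))// ltrDl.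
(* This endpoint is positive and strictly beyond the support, so [phi] vanishes at it. *)
exists (`|b| + 1); first by rewrite ltr_wpDl.
have E n x : ~ (0 < x <= `|b| + 1) -> derive1n n phi x = 0.
  move=> /negP H; apply: (derive1n_support _ phi0).
  apply: contra H; rewrite in_itv/= => /andP[ax xb].
  by rewrite (lt_le_trans a0)//= (le_trans xb)// ltW.
split=> //; apply: phi0; rewrite in_itv/= [_ <= b]leNgt b0 andbF//.
Qed.

(** The condition that [distr_deriv 1] imposes on the real part and on the imaginary part
    separately; see [distr_deriv1E]. *)
Definition wderiv f g := forall phi, test_function phi ->
  \int[mu]_(x in D) (derive1n 1 phi x * f x) =
  - \int[mu]_(x in D) (phi x * g x).

Lemma Rintegral_halfline_support b h : (forall x, ~ (0 < x <= b) -> h x = 0) ->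
  \int[mu]_(x in D) h x = \int[mu]_(x in `]0, b]) h x.
Proof.
move=> h0; have <- : D `&` `]0, b]%classic = `]0, b]%classic.
  by apply/setIidr => x; rewrite halflineE/= in_itv/= => /andP[].
rewrite Rintegral_mkcondr; apply: eq_Rintegral => x _.
rewrite patchE; case: ifPn => // /negP xI; apply: h0 => x0b; apply: xI.
by rewrite inE/= in_itv.
Qed.

(** The product rule for [phi], seen as the primitive of its derivative, and [prim c g] on ]0, b]:
    both boundary terms vanish because [phi] is 0 at 0 and at b. *)
Lemma prim_wderiv c g : intloc g -> wderiv (prim c g) g.
Proof.
move=> gi phi tphi; have [b b0 [phib sphi]] := test_support tphi.
have sphi0 x : ~ (0 < x <= b) -> phi x = 0 by exact: (sphi 0).
rewrite (@Rintegral_halfline_support b); last first.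
  by move=> x x0b; rewrite sphi// mul0r.
rewrite (@Rintegral_halfline_support b); last first.
  by move=> x x0b; rewrite sphi0// mul0r.
have cphi : continuous phi := @test_continuous phi 0 tphi.
have cphi' := @test_continuous phi 1 tphi.
have phiE x : 0 <= x -> prim 0 (fun x => derive1n 1 phi x) x = phi x.
  move=> x0; have <- := @prim_FTC phi _ x (fun y => test_derive y tphi) cphi' x0.
  by rewrite sphi0// ltxx.
have := @primM _ 0 c (fun x => derive1n 1 phi x) g b (continuous_intloc cphi') gi.
rewrite (phiE b) ?ltW// phib !mul0r prim_cst0.
rewrite RintegralD//; first last.
- apply: intlocM => //; apply: prim_continuous; exact: continuous_intloc.
- apply: (@eq_integrableR _ _ (fun x => prim c g x * derive1n 1 phi x)) => //.
    by move=> x _; rewrite mulrC.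
  apply: intlocM; first exact: prim_continuous.
  exact: continuous_intloc.
move/eqP; rewrite addr_eq0 => /eqP ->; congr (- _).
apply: eq_Rintegral => x; rewrite inE/= in_itv/= => /andP[x0 _].
by rewrite phiE// ltW.
Qed.

End WeakDerivative.

(** * Functions with zero weak derivative are constant (du Bois-Reymond) *)

Section WeakConstant.
Variable R : realType.
Local Notation mu := (@lebesgue_measure R).
Local Notation D := (@halfline R).
Implicit Types (f g h phi : R -> R).

(** The derivative of [scaled_step r a]: a one-sided approximate identity supported in [a, a + r],
    of total mass [step 1]. *)
Definition mollifier (r a x : R) : R := r^-1 * bump (r^-1 * x + - (r^-1 * a)).

Definition scaled_step (r a x : R) : R := step (r^-1 * x + - (r^-1 * a)).

Lemma affineE (r a x : R) : r^-1 * x + - (r^-1 * a) = (x - a) / r.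
Proof. by rewrite -mulrBr mulrC. Qed.

Lemma smooth_scaled_step r a : smooth (scaled_step r a).
Proof. by apply: smooth_affine; exact: smooth_step. Qed.

Lemma smooth_mollifier r a : smooth (mollifier r a).
Proof.
apply: smoothM; first exact: smooth_cst.
by apply: smooth_affine; exact: smooth_bump.
Qed.

Lemma scaled_step_derive r a x :
  is_derive x (1 : R) (scaled_step r a) (mollifier r a x).
Proof.
have da : is_derive x (1 : R) (fun y : R => r^-1 * y + - (r^-1 * a)) r^-1.
  have H : is_derive x (1 : R) ((r^-1 \*: @id R) + cst (- (r^-1 * a))) (r^-1 *: 1 + 0).
    exact: is_deriveD.
  by apply: is_derive_eq H _; rewrite /GRing.scale/= mulr1 addr0.
rewrite /mollifier mulrC.
exact: (@is_derive1_comp _ (@step R) (fun y : R => r^-1 * y + - (r^-1 * a)) _ _ _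
  (step_derive _) da).
Qed.

Lemma mollifier_out r a x : 0 < r -> ~ (a < x < a + r) -> mollifier r a x = 0.
Proof.
move=> r0 xar; rewrite /mollifier affineE bump_out ?mulr0// => /andP[h1 h2].
apply: xar; move: h1 h2.
by rewrite pmulr_lgt0 ?invr_gt0// subr_gt0 ltr_pdivrMr// mul1r ltrBlDl => -> ->.
Qed.

Lemma mollifier_ge0 r a x : 0 < r -> 0 <= mollifier r a x.
Proof. by move=> r0; rewrite mulr_ge0 ?bump_ge0// invr_ge0 ltW. Qed.

Lemma mollifier_le r a x : 0 < r -> mollifier r a x <= r^-1.
Proof. by move=> r0; rewrite ler_piMr ?bump_le1// invr_ge0 ltW. Qed.

(** Both steps vanish to the left of min(a, b) and equal [step 1] to the right of max(a, b) + r. The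
    derivative of the difference is a difference of mollifiers, so testing against it compares the
    averages of a function near a and near b. *)
Lemma test_step_diff r a b : 0 < r -> 0 < a -> 0 < b ->
  test_function (fun x => scaled_step r a x - scaled_step r b x).
Proof.
move=> r0 a0 b0.
have sm : smooth (fun x => scaled_step r a x - scaled_step r b x).
  have -> : (fun x => scaled_step r a x - scaled_step r b x) =
     (fun x => scaled_step r a x + (fun x => -1 * scaled_step r b x) x).
    by apply/funext => x; rewrite mulN1r.
  apply: smoothD; first exact: smooth_scaled_step.
  by apply: smoothM; [exact: smooth_cst|exact: smooth_scaled_step].
split; first by move=> n x; exact: smooth_derivable.
exists (Num.min a b), (Num.max a b + r); split; first by rewrite lt_min a0.
move=> x; rewrite in_itv/= negb_and -!ltNge /scaled_step !affineE => /orP[|].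
  rewrite lt_min => /andP[xa xb].
  by rewrite !step0 ?subrr// pmulr_lle0 ?invr_gt0// subr_le0 ltW.
rewrite -ltrBrDr => xr.
have H c : c <= Num.max a b -> 1 <= (x - c) / r.
  move=> cab; rewrite ler_pdivlMr// mul1r lerBrDr -lerBrDl.
  by rewrite (le_trans cab)// ltW.
by rewrite (step1 (H a _)) ?le_max ?lexx// (step1 (H b _)) ?subrr ?le_max ?lexx ?orbT.
Qed.

Lemma Rintegral_ball (a r : R) h : mu.-integrable `[a - r, a + r] (EFin \o h) ->
  \int[mu]_(x in `[a - r, a + r]) h x = \int[mu]_(x in ball a r) h x.
Proof.
move=> hi; rewrite ball_itv.
rewrite Rintegral_itv_bndo_bndc; last first.
  apply: integrableS hi => // z; rewrite /= !in_itv/=.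
  by move=> /andP[/ltW -> /ltW ->].
rewrite Rintegral_itv_obnd_cbnd//.
by apply: integrableS hi => //; exact: subset_itv_oc_cc.
Qed.

Lemma mollifier_integral a r : 0 < r ->
  \int[mu]_(x in ball a r) mollifier r a x = step 1.
Proof.
move=> r0.
have cm := smooth_continuous (smooth_mollifier r a).
have cs := smooth_continuous (smooth_scaled_step r a).
have ar : a - r < a + r by rewrite ltrD2l gt0_cp.
rewrite -Rintegral_ball; last first.
  apply: continuous_compact_integrable; first exact: segment_compact.
  exact: continuous_subspaceT.
rewrite /Rintegral (@continuous_FTC2 _ _ (scaled_step r a))//.
- rewrite /= /scaled_step !affineE.
  rewrite addrAC subrr add0r divff ?gt_eqF//.
  rewrite [X in _ - X]step0 ?subr0// addrAC subrr add0r mulNr divff ?gt_eqF//.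
- exact: continuous_subspaceT.
- split.
  + by move=> y _; have [] := scaled_step_derive r a y.
  + exact: cvg_at_right_filter (cs _).
  + exact: cvg_at_left_filter (cs _).
- by move=> y _; rewrite derive1E; have [_] := scaled_step_derive r a y.
Qed.

(** The mollifier is at most 1/r on the ball of radius r, so the error is at most twice the mean of
    |h - h(a)| over this ball, which tends to 0 at a Lebesgue point. *)
Lemma lebesgue_pt_mollifier h a : mu.-integrable setT (EFin \o h) ->
  lebesgue_pt h a ->
  \int[mu]_x (mollifier r a x * h x) @[r --> 0^'+] --> step 1 * h a.
Proof.
move=> hi /fine_cvgP[hfin hlim].
have mball r : @measurable _ (measurableTypeR R) (ball a r) by exact: measurable_ball.
have mm r A : measurable_fun A (mollifier r a).
  apply: measurable_funTS; apply: continuous_measurable_fun.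
  exact: smooth_continuous (smooth_mollifier r a).
apply/cvgrPdist_le => e e0; near=> r.
have r0 : 0 < r by near: r; exact: nbhs_right_gt.
have hir : mu.-integrable (ball a r) (EFin \o h) by exact: integrableS hi.
have ci c : mu.-integrable (ball a r) (EFin \o (fun=> c)).
  apply: (@integrableS _ _ _ mu `[a - r, a + r]) => //.
    by rewrite ball_itv; exact: subset_itv_oo_cc.
  apply: continuous_compact_integrable; first exact: segment_compact.
  by apply: continuous_subspaceT => x; exact: cvg_cst.
have Mi g : mu.-integrable (ball a r) (EFin \o g) ->
    mu.-integrable (ball a r) (EFin \o (fun x => mollifier r a x * g x)).
  move=> gi; apply: (@integrableR_bounded_mul _ _ _ _ r^-1) => // x _.
  by rewrite ger0_norm ?mollifier_ge0 ?mollifier_le.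
have -> : \int[mu]_x (mollifier r a x * h x) =
    \int[mu]_(x in ball a r) (mollifier r a x * h x).
  rewrite [RHS]Rintegral_mkcond; apply: eq_Rintegral => x _.
  rewrite patchE; case: ifPn => // /negP xB.
  rewrite mollifier_out ?mul0r// => /andP[ax xr]; apply: xB.
  by rewrite inE ball_itv/= in_itv/= xr andbT (lt_trans _ ax)// gtrBl.
have -> : step 1 * h a = \int[mu]_(x in ball a r) (mollifier r a x * h a).
  rewrite RintegralZr//; first by rewrite mollifier_integral.
  apply: (@eq_integrableR _ _ (fun x => mollifier r a x * 1)) => //; last exact: Mi.
  by move=> x _; rewrite mulr1.
rewrite -RintegralB//; [|exact: Mi|exact: Mi].
have di : mu.-integrable (ball a r) (EFin \o (fun x => h x - h a)) by exact: integrableRB.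
have di' : mu.-integrable (ball a r)
   (EFin \o (fun x => mollifier r a x * h a - mollifier r a x * h x)).
  by apply: integrableRB => //; exact: Mi.
apply: le_trans (le_normr_Rintegral _ di') _ => //.
apply: (@le_trans _ _ (\int[mu]_(x in ball a r) (r^-1 * `|h x - h a|))).
  apply: le_Rintegral => //.
  - exact: integrable_norm.
  - by apply: integrableRZ => //; exact: integrable_norm.
  move=> x _; rewrite -mulrBr normrM distrC ler_wpM2r//.
  by rewrite ger0_norm ?mollifier_ge0 ?mollifier_le.
rewrite RintegralZl//; last exact: integrable_norm.
have dfin : davg h a r \is a fin_num by near: r.
(* The factor 2 compares the bound 1/r with the inverse 1/(2r) of the measure of the ball. *)
have dlt : fine (davg h a r) < e / 2.
  near: r.
  by apply: (cvgr_lt _ hlim); rewrite divr_gt0.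
have r1 : 0 <= (r *+ 2)^-1 by rewrite invr_ge0 mulrn_wge0// ltW.
have dE : fine (davg h a r) = (r *+ 2)^-1 * \int[mu]_(x in ball a r) `|h x - h a|.
  have -> : davg h a r = ((r *+ 2)^-1 * \int[mu]_(x in ball a r) `|h x - h a|)%:E.
    rewrite /davg /iavg lebesgue_measure_ball ?ltW// EFinM.
    rewrite inver mulrn_eq0/= gt_eqF//; congr (_ * _)%E.
    by rewrite -EFin_Rintegral//; exact: integrable_norm.
  by [].
have -> : r^-1 = 2 * (r *+ 2)^-1.
  by rewrite -mulr_natr; field; rewrite gt_eqF.
by rewrite -mulrA -dE mulrC -ler_pdivlMr// ltW.
Unshelve. all: by end_near. Qed.

Lemma mollifier_int r a h : 0 < r -> mu.-integrable setT (EFin \o h) ->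
  mu.-integrable setT (EFin \o (fun x => mollifier r a x * h x)).
Proof.
move=> r0; apply: (@integrableR_bounded_mul _ _ _ _ r^-1) => //.
  apply: continuous_measurable_fun.
  exact: smooth_continuous (smooth_mollifier r a).
by move=> x _; rewrite ger0_norm ?mollifier_ge0 ?mollifier_le.
Qed.

(** At any two Lebesgue points a and x the mollified values of [f] agree for small r, by testing
    against a difference of steps. Their limits are [step 1] times f(a) and f(x). *)
Lemma wderiv0_cst f : locally_integrable D f -> wderiv f (fun=> 0) ->
  exists c, ae_eq mu D f (cst c).
Proof.
move=> [mf _ lf] f0.
(* Truncation to compact intervals exhausting the half-line makes [f] integrable on the line. As
   there are countably many of them, almost every point is a Lebesgue point of all truncations. *)
pose I (k : nat) := `[k.+1%:R^-1, k.+1%:R : R]%classic.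
have ID k : I k `<=` D.
  by move=> x; rewrite halflineE /I/= in_itv/= => /andP[+ _]; apply: lt_le_trans.
have Ii k : mu.-integrable setT (EFin \o f \_ (I k)).
  have mI : @measurable _ (measurableTypeR R) (I k) by exact: measurable_itv.
  apply/integrableR_restrict => //; rewrite setTI; apply/integrableP; split.
    apply/measurable_EFinP; apply: measurable_funS mf => //.
    exact: halfline_measurable.
  by apply: lf => //; exact: segment_compact.
have Q : {ae mu, forall x, forall k, lebesgue_pt (f \_ (I k)) x}.
  apply: ae_foralln => k; apply: lebesgue_differentiation.
  by apply: open_integrable_locally => //; exact: openT.
(* A reference point, fixed once; its value is the constant. *)
have [a [a0 _ Qa]] : exists x, [/\ 0 < x, x < 1 & forall k, lebesgue_pt (f \_ (I k)) x].
  apply: ae_halfline_exists => //.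
  by apply: (@filterS _ _ (ae_filter_ringOfSetsType mu)) Q => x Qx _.
exists (f a); apply: (@filterS _ _ (ae_filter_ringOfSetsType mu)) Q => x Qx.
rewrite halflineE => x0.
have [k [ak [ak' [xk xk']]]] : exists k : nat,
    k.+1%:R^-1 < a /\ a < k.+1%:R /\ k.+1%:R^-1 < x /\ x < k.+1%:R.
  have := @truncnS_gt R (a^-1 + a + x^-1 + x); set k := Num.trunc _ => H.
  have [a1 x1] : 0 < a^-1 /\ 0 < x^-1 by rewrite !invr_gt0.
  exists k; split; first by rewrite invf_plt ?posrE//; lra.
  split; first by lra.
  split; first by rewrite invf_plt ?posrE//; lra.
  lra.
have fE y : k.+1%:R^-1 <= y <= k.+1%:R -> (f \_ (I k)) y = f y.
  by move=> yI; rewrite patchE mem_set//= in_itv.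
have La := lebesgue_pt_mollifier (Ii k) (Qa k).
have Lx := lebesgue_pt_mollifier (Ii k) (Qx k).
(* For small r both mollifiers live inside [I k], where the truncation coincides with [f]; the weak
   equation for [f] itself then applies. *)
have AB : \forall r \near 0^'+,
    \int[mu]_y (mollifier r x y * (f \_ (I k)) y) =
    \int[mu]_y (mollifier r a y * (f \_ (I k)) y).
  near=> r.
  have r0 : 0 < r by near: r; exact: nbhs_right_gt.
  have ar : a + r <= k.+1%:R.
    by rewrite -lerBrDl; near: r; apply: nbhs_right_le; rewrite subr_gt0.
  have xr : x + r <= k.+1%:R.
    by rewrite -lerBrDl; near: r; apply: nbhs_right_le; rewrite subr_gt0.
  apply/eqP; rewrite -subr_eq0 -RintegralB//; [|exact: mollifier_int..].
  have /f0 := test_step_diff r0 x0 a0.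
  have -> : \int[mu]_(y in D) ((scaled_step r x y - scaled_step r a y) * 0) = 0.
    by rewrite /Rintegral integral0_eq// => y _; rewrite mulr0.
  rewrite oppr0 => H; apply/eqP; rewrite -[RHS]H.
  rewrite [in RHS]Rintegral_mkcond; apply: eq_Rintegral => y _.
  rewrite [in RHS]patchE.
  have -> : derive1n 1 (fun y => scaled_step r x y - scaled_step r a y) y =
      mollifier r x y - mollifier r a y.
    rewrite derive1n1 derive1E.
    have [_ <-] := scaled_step_derive r x y.
    have [_ <-] := scaled_step_derive r a y.
    by apply: deriveB; [have [] := scaled_step_derive r x y|
      have [] := scaled_step_derive r a y].
  have E c : k.+1%:R^-1 < c -> c + r <= k.+1%:R ->
      mollifier r c y * (f \_ (I k)) y = mollifier r c y * f y.
    move=> kc ck; have [/andP[cy yc]|cy] := pselect (c < y < c + r).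
      by rewrite fE// (ltW (lt_trans kc cy)) (le_trans (ltW yc)).
    by rewrite mollifier_out// !mul0r.
  case: ifPn => [_|/negP yD].
    by rewrite mulrBl E// E.
  have -> : (f \_ (I k)) y = 0.
    by rewrite patchE memNset// => /ID yD'; apply: yD; rewrite inE.
  by rewrite !mulr0 subrr.
have ax := @cvg_unique R (@Rhausdorff R) _ _ _ _ La (cvg_trans (near_eq_cvg AB) Lx).
have /= := mulfI (lt0r_neq0 (step1_gt0 R)) (ax _ _).
by rewrite !fE ?(ltW ak) ?(ltW ak') ?(ltW xk) ?(ltW xk')// => ->.
Unshelve. all: by end_near. Qed.

End WeakConstant.

(** * Square-integrable functions and behaviour at infinity *)

Section SquareIntegrable.
Variable R : realType.
Local Notation mu := (@lebesgue_measure R).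
Local Notation D := (@halfline R).
Implicit Types (f g h k : R -> R).

Let mD : @measurable _ (measurableTypeR R) D := @halfline_measurable R.

Lemma halfline_bigcup : D = \bigcup_n `]0, n%:R : R]%classic.
Proof.
rewrite /halfline itv_bndy_bigcup_BRight; apply: eq_bigcupr => n _.
by rewrite add0r.
Qed.

Lemma subset_oc_halfline (a b : R) : 0 <= a -> `]a, b] `<=` D.
Proof.
by move=> a0 x; rewrite halflineE/= in_itv/= => /andP[ax _]; exact: le_lt_trans ax.
Qed.

Lemma Rintegral_subset (A B : set R) f : (@measurable _ (measurableTypeR R) A) ->
  (@measurable _ (measurableTypeR R) B) -> A `<=` B -> mu.-integrable B (EFin \o f) ->
  (forall x, B x -> 0 <= f x) ->
  \int[mu]_(x in A) f x <= \int[mu]_(x in B) f x.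
Proof.
move=> mA mB AB fi f0; rewrite -lee_fin -!EFin_Rintegral//; last exact: integrableS fi.
apply: ge0_subset_integral => //; first by have /integrableP[] := fi.
Qed.

Lemma ge0_cvg_integral_halfline f : measurable_fun D f -> (forall x, D x -> 0 <= f x) ->
  (\int[mu]_(x in `]0%R, n%:R%R]) (f x)%:E)%E @[n --> \oo] -->
  (\int[mu]_(x in D) (f x)%:E)%E.
Proof.
move=> mf f0; rewrite halfline_bigcup.
apply: ge0_nondecreasing_set_cvg_integral.
- by move=> m n mn; apply/subsetPset/subset_itvl; rewrite bnd_simp ler_nat.
- by move=> i; exact: measurable_itv.
- move=> i; apply/measurable_EFinP; apply: measurable_funS mf => //.
  exact: subset_oc_halfline.
- by move=> i x xi; rewrite lee_fin f0//; exact: subset_oc_halfline xi.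
Qed.

(** Monotone convergence along ]0, n]. *)
Lemma integrable_bounded_halfline f M : measurable_fun D f ->
  (forall x, D x -> 0 <= f x) -> intloc f ->
  (forall b, 0 < b -> \int[mu]_(x in `]0, b]) f x <= M) ->
  mu.-integrable D (EFin \o f) /\ \int[mu]_(x in D) f x <= M.
Proof.
move=> mf f0 fi fM.
have H : (\int[mu]_(x in D) (f x)%:E <= M%:E)%E.
  have cf := ge0_cvg_integral_halfline mf f0.
  apply: (cvge_le _ cf) => //.
  near=> n; rewrite EFin_Rintegral// lee_fin fM// ltr0n.
  by near: n; exact: nbhs_infty_gt.
have fD : mu.-integrable D (EFin \o f).
  apply/integrableP; split; first exact/measurable_EFinP.
  under eq_integral do rewrite /=.
  apply: (le_lt_trans _ (ltry M)); apply: le_trans H.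
  rewrite le_eqVlt; apply/orP; left; apply/eqP; apply: eq_integral => x /set_mem Dx.
  by rewrite ger0_norm// f0.
split=> //; by rewrite -lee_fin -EFin_Rintegral.
Unshelve. all: by end_near. Qed.

(** The tail of the integral of f is dominated by that of |f|, whose truncated integrals converge by
    monotone convergence. *)
Lemma Rintegral_halfline_tail f : mu.-integrable D (EFin \o f) -> forall e, 0 < e ->
  exists2 n : R, 0 < n & forall x, n <= x ->
    `|\int[mu]_(t in D) f t - \int[mu]_(t in `]0, x]) f t| <= e.
Proof.
move=> fi e e0.
have fn : mu.-integrable D (EFin \o (fun x => `|f x|)) := integrable_norm fi.
have fn' b : mu.-integrable `]0, b] (EFin \o (fun x => `|f x|)).
  by apply: integrableS fn => //; exact: subset_oc_halfline.
have ft x : 0 < x -> mu.-integrable `]x, +oo[ (EFin \o f).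
  move=> x0; apply: integrableS fi => //.
  by move=> y; rewrite halflineE/= in_itv/= andbT; exact: lt_trans.
have mfn : measurable_fun D (fun x => `|f x|) by exact: integrableR_measurable fn.
pose S b := \int[mu]_(x in `]0, b]) `|f x|.
have SE : (fun n : nat => S n%:R) n @[n --> \oo] --> \int[mu]_(x in D) `|f x|.
  have := ge0_cvg_integral_halfline mfn (fun x _ => normr_ge0 _).
  by rewrite EFin_Rintegral// => /fine_cvgP[_].
have [n _ nP] := cvgr_distC_le _ _ SE e e0.
exists n.+1%:R; first by rewrite ltr0n.
move=> x nx.
have x0 : 0 < x by apply: lt_le_trans nx; rewrite ltr0n.
rewrite Rintegral_itvB ?bnd_simp//; last exact: ltW.
apply: le_trans (le_normr_Rintegral _ (ft _ x0)) _ => //.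
have H : `|S n.+1%:R - \int[mu]_(x in D) `|f x| | <= e := nP n.+1 (leqnSn n).
apply: (le_trans _ H).
rewrite distrC; apply: (le_trans _ (ler_norm _)).
rewrite -(@Rintegral_itvB _ _ (BRight 0))//.
  rewrite lerD2l lerN2 /S -subr_ge0.
  rewrite Rintegral_itvB ?bnd_simp//.
  by apply: Rintegral_ge0.
by rewrite bnd_simp ltW.
Qed.

Definition sqint f := measurable_fun D f /\
  mu.-integrable D (EFin \o (fun x => f x ^+ 2)).

Lemma sqintM f g : sqint f -> sqint g ->
  mu.-integrable D (EFin \o (fun x => f x * g x)).
Proof.
move=> [mf f2] [mg g2]; apply: (@le_integrableR _ _ _ (fun x => f x ^+ 2 + g x ^+ 2)) => //.
- exact: measurable_funM.
- move=> x _; rewrite normrM -[f x ^+ 2]real_normK ?num_real//.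
  rewrite -[g x ^+ 2]real_normK ?num_real//.
  have := normr_ge0 (f x); have := normr_ge0 (g x).
  have := sqr_ge0 (`|f x| - `|g x|).
  nra.
- exact: integrableRD.
Qed.

Lemma sqint_intloc f : sqint f -> intloc f.
Proof.
move=> [mf f2] b.
have bD : `]0, b]%classic `<=` D by exact: subset_oc_halfline.
have f2b : mu.-integrable `]0, b] (EFin \o (fun x => f x ^+ 2)).
  exact: integrableS f2.
have i1 : mu.-integrable `]0, b] (EFin \o (fun=> 1)).
  by apply: continuous_intloc => x; exact: cvg_cst.
apply: (@le_integrableR _ _ _ (fun x => 1 + f x ^+ 2)) => //.
- exact: measurable_funS mf.
- move=> x _; rewrite -[f x ^+ 2]real_normK ?num_real//.
  have := normr_ge0 (f x); have := sqr_ge0 (`|f x| - 1); nra.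
- exact: integrableRD.
Qed.

Lemma prim_measurable c f (A : set R) : intloc f -> measurable_fun A (prim c f).
Proof.
move=> fi; apply: measurable_funTS; apply: continuous_measurable_fun.
exact: prim_continuous.
Qed.

(** The second hypothesis says that f tends to l at infinity. If l were nonzero, |f| >= |l|/2 beyond
    some n, and (b - n) |l|/2 would stay below the integral of |f| for every b. *)
Lemma integrable_cvg0 f l : mu.-integrable D (EFin \o f) ->
  (forall e, 0 < e -> exists2 n, 0 < n & forall x, n <= x -> `|l - f x| <= e) ->
  l = 0.
Proof.
move=> fi fl; apply/eqP/negPn/negP => l0.
have e0 : 0 < `|l| / 2 by rewrite divr_gt0// normr_gt0.
have [n n0 nP] := fl _ e0.
have fn : mu.-integrable D (EFin \o (fun x => `|f x|)) := integrable_norm fi.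
pose M := \int[mu]_(x in D) `|f x|.
have nD b : `]n, b]%classic `<=` D by apply: subset_oc_halfline; exact: ltW.
have H b : n <= b -> (b - n) * (`|l| / 2) <= M.
  move=> nb; apply: (@le_trans _ _ (\int[mu]_(x in `]n, b]) (`|l| / 2))).
    have mnb : fine (mu `]n, b]%classic) = b - n.
      rewrite lebesgue_measure_itv/= lte_fin.
      case: ltP => [_|bn] //=; apply/esym/eqP; by rewrite subr_eq0 eq_le nb bn.
    by rewrite Rintegral_cst// [fine _]mnb mulrC.
  apply: (@le_trans _ _ (\int[mu]_(x in `]n, b]) `|f x|)).
    apply: le_Rintegral => //.
    - apply: (@integrableS _ _ _ mu `]0, b]) => //.
        by apply: subset_itvr; rewrite bnd_simp ltW.
      by apply: continuous_intloc => x; exact: cvg_cst.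
    - by apply: integrableS fn => //; exact: nD.
    move=> x; rewrite /= in_itv/= => /andP[/ltW/nP H _].
    have := ler_normD (l - f x) (f x); rewrite subrK => H'.
    rewrite -(lerD2l (`|l| / 2)); apply: (@le_trans _ _ `|l|); first by lra.
    by apply: le_trans H' _; rewrite lerD2r.
  by apply: Rintegral_subset => //; exact: nD.
have M0 : 0 <= M by apply: Rintegral_ge0.
have q0 : 0 <= (M + 1) / (`|l| / 2) by rewrite divr_ge0// ?addr_ge0// ltW.
(* This b turns the bound into M + 1 <= M. *)
have := H (n + (M + 1) / (`|l| / 2)); rewrite lerDl q0 => /(_ isT).
rewrite addrAC subrr add0r divfK ?gt_eqF//.
by rewrite gerDl leNgt ltr01.
Qed.

(* The boundary term at infinity vanishes, as [F * G] is integrable and has a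
   limit. *)
Lemma integration_by_parts_halfline c d f g : sqint f -> sqint g ->
  sqint (prim c f) -> sqint (prim d g) ->
  \int[mu]_(x in D) (f x * prim d g x + prim c f x * g x) = - (c * d).
Proof.
move=> Lf Lg LF LG.
have [fi gi] := (sqint_intloc Lf, sqint_intloc Lg).
have hi : mu.-integrable D
    (EFin \o (fun x => f x * prim d g x + prim c f x * g x)).
  by apply: integrableRD => //; exact: sqintM.
apply/eqP; rewrite eq_sym eqr_oppLR -addr_eq0; apply/eqP.
apply: (integrable_cvg0 (sqintM LF LG)) => e e0.
have [n n0 nP] := Rintegral_halfline_tail hi e0.
exists n => // x nx; rewrite -primM// /prim opprD addrACA subrr add0r.
exact: nP.
Qed.

(** f - [prim 0 g] has zero weak derivative, hence is a constant. *)
Lemma wderiv_prim f g : locally_integrable D f -> intloc g -> wderiv f g ->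
  exists c, ae_eq mu D f (prim c g).
Proof.
move=> lf gi fg.
have lG : locally_integrable D (prim 0 g).
  split; [exact: prim_measurable|exact: halfline_open|].
  move=> K KD cK.
  have : mu.-integrable K (EFin \o prim 0 g).
    apply: continuous_compact_integrable => //.
    by apply: continuous_subspaceT; exact: prim_continuous.
  by move=> /integrableP[].
have mDz : measurable_fun D (fun=> 0 : R) by exact: measurable_cst.
have l0 : locally_integrable D (fun=> 0 : R).
  split; [by []|exact: halfline_open|].
  by move=> K _ _; under eq_integral do rewrite normr0; rewrite integral0.
have ti h phi n : locally_integrable D h -> test_function phi ->
    mu.-integrable D (EFin \o (fun x => derive1n n phi x * h x)).
  move=> lh tphi.
  have lhC : loc_integrable (fun x => (h x)%:C) by split.
  have [+ _] := test_cintegrable n tphi lhC.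
  by apply: eq_integrable => // x _ /=; rewrite mul0r subr0.
have [||c cP] := @wderiv0_cst _ (fun x => f x - prim 0 g x).
- exact: locally_integrableB.
- move=> phi tphi; have e1 := prim_wderiv 0 gi tphi.
  have -> : \int[mu]_(x in D) (phi x * 0) = 0.
    by rewrite /Rintegral integral0_eq// => y _; rewrite mulr0.
  under eq_Rintegral do rewrite mulrBr.
  rewrite RintegralB//; [|exact: ti..].
  by rewrite (fg _ tphi) e1 subrr oppr0.
exists c; apply: filterS cP => x /= + Dx => /(_ Dx) H.
by rewrite -(subrK (prim 0 g x) (f x)) H /prim add0r.
Qed.

End SquareIntegrable.

(** * First-order equations on the half-line *)

Section FirstOrderODE.
Variable R : realType.
Local Notation mu := (@lebesgue_measure R).
Local Notation D := (@halfline R).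
Implicit Types (f g h k q : R -> R).
Let mD : @measurable _ (measurableTypeR R) D := @halfline_measurable R.

Lemma exp_derive (s x : R) :
  is_derive x (1 : R) (fun t : R => expR (s * t)) (s * expR (s * x)).
Proof.
have da : is_derive x (1 : R) (fun y : R => s * y) s.
  have H : is_derive x (1 : R) (s \*: @id R) (s *: (1 : R)) by exact: is_deriveZ.
  by apply: is_derive_eq H _; rewrite /GRing.scale/= mulr1.
rewrite mulrC.
exact: (@is_derive1_comp _ expR (fun y : R => s * y) _ _ _ (is_derive_expR _) da).
Qed.

Lemma exp_continuous (s : R) : continuous (fun t : R => expR (s * t)).
Proof. exact: is_derive_continuous (exp_derive s). Qed.

Lemma prim_exp (s x : R) : 0 <= x ->
  prim 1 (fun t => s * expR (s * t)) x = expR (s * x).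
Proof.
move=> x0; rewrite -[in LHS](@expR0 R) -[in LHS](mulr0 s).
apply: (@prim_FTC _ (fun t : R => expR (s * t)) (fun t => s * expR (s * t))) => //.
  exact: exp_derive.
move=> y; apply: cvgM; first exact: cvg_cst.
exact: exp_continuous.
Qed.

(** Variation of constants: the product rule for exp(s x) and the primitive of exp(-s t) k(t) yields
    the integral form of q' = s q + k. *)
Lemma ode_solution s c k : intloc k ->
  exists2 q, forall x, q x = prim c (fun t => s * q t + k t) x &
    continuous q /\ forall x, 0 <= x ->
      q x = expR (s * x) * prim c (fun t => expR (- s * t) * k t) x.
Proof.
move=> ki.
have ei : intloc (fun t => expR (- s * t) * k t).
  by apply: intlocM => //; exact: exp_continuous.
have Ei : intloc (fun t : R => s * expR (s * t)).
  by apply: continuous_intloc => x; apply: cvgM; [exact: cvg_cst|exact: exp_continuous].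
pose q0 x := expR (s * x) * prim c (fun t => expR (- s * t) * k t) x.
have cq0 : continuous q0.
  by move=> x; apply: cvgM; [exact: exp_continuous|exact: prim_continuous].
(* For x < 0 the explicit formula is c exp(s x), while a primitive stays equal to c. Taking [q] to
   be a primitive makes the integral equation hold for every x. *)
pose q := prim c (fun t => s * q0 t + k t).
have qi : intloc (fun t => s * q0 t + k t).
  by apply: intloc_lin => //; exact: continuous_intloc.
have qE x : 0 <= x -> q x = q0 x.
  move=> x0; rewrite /q0 -(prim_exp s x0) -primM// mul1r.
  apply: eq_prim => t t0; rewrite (prim_exp s (ltW t0)) /q0 [LHS]addrC [RHS]addrC.
  rewrite !mulrA -expRD mulNr addrN expR0 mul1r; congr (_ + _).
exists q; last by split => //; exact: prim_continuous.
move=> x; apply: eq_prim => t t0; by rewrite qE// ltW.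
Qed.

(** (q^2)' = 2 q q' in integrated form. *)
Lemma ode_energy s c k q : intloc k -> continuous q ->
  (forall x, q x = prim c (fun t => s * q t + k t) x) -> forall b,
  q b ^+ 2 = c ^+ 2 +
    \int[mu]_(t in `]0, b]) (2 * s * q t ^+ 2 + 2 * (q t * k t)).
Proof.
move=> ki cq qE b.
have qi : intloc (fun t => s * q t + k t).
  by apply: intloc_lin => //; exact: continuous_intloc.
rewrite expr2 (qE b) -primM// /prim expr2; congr (_ + _).
apply: eq_Rintegral => t _; rewrite -/(prim _ _ _) -qE; ring.
Qed.

Lemma continuous_sqr q : continuous q -> continuous (fun t => q t ^+ 2).
Proof. by move=> cq x; exact: cvgM (cq x) (cq x). Qed.

(** Pointwise s (q^2)' - (q^2 - k^2) = (q + s k)^2. Thus the integral of q^2 is controlled by that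
    of k^2 and by the boundary values of q^2. *)
Lemma ode_energy_le s k q b : (s = 1 \/ s = -1) -> sqint k -> continuous q ->
  s * \int[mu]_(t in `]0, b]) (2 * s * q t ^+ 2 + 2 * (q t * k t)) >=
  \int[mu]_(t in `]0, b]) (q t ^+ 2) - \int[mu]_(t in D) (k t ^+ 2).
Proof.
move=> s1 Lk cq; have ki := sqint_intloc Lk.
have [mk k2] := Lk.
have q2i : intloc (fun t => q t ^+ 2).
  by apply: continuous_intloc; exact: continuous_sqr.
have k2i : mu.-integrable `]0, b] (EFin \o (fun t => k t ^+ 2)).
  by apply: integrableS k2 => //; exact: subset_oc_halfline.
have mixi : intloc (fun t => 2 * s * q t ^+ 2 + 2 * (q t * k t)).
  move=> e; apply: integrableRD => //; first exact: integrableRZ.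
  by apply: integrableRZ => //; exact: intlocM.
apply: (@le_trans _ _ (\int[mu]_(t in `]0, b]) (q t ^+ 2 - k t ^+ 2))).
  rewrite RintegralB// lerD2l lerN2.
  by apply: Rintegral_subset => //; [exact: subset_oc_halfline|move=> x _; exact: sqr_ge0].
rewrite -RintegralZl//; apply: le_Rintegral => //.
- exact: integrableRB.
- exact: integrableRZ.
move=> t _; rewrite -subr_ge0.
case: s1 => ->.
- have -> : 1 * (2 * 1 * q t ^+ 2 + 2 * (q t * k t)) - (q t ^+ 2 - k t ^+ 2) =
    (q t + k t) ^+ 2 by ring.
  exact: sqr_ge0.
- have -> : -1 * (2 * -1 * q t ^+ 2 + 2 * (q t * k t)) - (q t ^+ 2 - k t ^+ 2) =
    (q t - k t) ^+ 2 by ring.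
  exact: sqr_ge0.
Qed.

Lemma continuous_sqint q M : continuous q ->
  (forall b, 0 < b -> \int[mu]_(t in `]0, b]) (q t ^+ 2) <= M) -> sqint q.
Proof.
move=> cq qM.
have mq : measurable_fun D q.
  by apply: measurable_funTS; exact: continuous_measurable_fun.
split => //; apply: (proj1 (integrable_bounded_halfline _ _ _ qM)).
- exact: measurable_funX.
- by move=> x _; exact: sqr_ge0.
- by apply: continuous_intloc; exact: continuous_sqr.
Qed.

(** For s = -1 the energy estimate reads: the integral of q^2 over ]0, b] is at most c^2 - q(b)^2
    plus that of k^2. The term at b has the favourable sign, so any initial value is allowed. *)
Lemma ode_forward c k : sqint k -> exists2 q,
  forall x, q x = prim c (fun t => -1 * q t + k t) x & sqint q.
Proof.
move=> Lk; have ki := sqint_intloc Lk.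
have [q qE [cq _]] := @ode_solution (-1) c k ki.
exists q => //.
apply: (@continuous_sqint _ (c ^+ 2 + \int[mu]_(t in D) (k t ^+ 2))) => // b b0.
have := @ode_energy_le (-1) k q b (or_intror erefl) Lk cq.
have := ode_energy ki cq qE b.
have := sqr_ge0 (q b); lra.
Qed.

(* The only square integrable solution is the one whose value at 0 is
   [- \int exp(-t) k(t)]. *)
Lemma ode_backward k : sqint k -> exists c, exists2 q,
  forall x, q x = prim c (fun t => 1 * q t + k t) x & sqint q.
Proof.
move=> Lk; have ki := sqint_intloc Lk.
have cE := @exp_continuous (-1).
have Ei : intloc (fun t : R => expR (-1 * t)) by exact: continuous_intloc.
have EI b : 0 < b -> \int[mu]_(t in `]0, b]) expR (-1 * t) = 1 - expR (-1 * b).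
  move=> b0.
  have := prim_exp (-1) (ltW b0); rewrite /prim RintegralZl//; lra.
have [ED EM] : mu.-integrable D (EFin \o (fun t : R => expR (-1 * t))) /\
    \int[mu]_(t in D) expR (-1 * t) <= 1.
  apply: integrable_bounded_halfline => //.
  - by apply: measurable_funTS; exact: continuous_measurable_fun.
  - by move=> b b0; rewrite EI// gerBl expR_ge0.
pose h t := expR (- (1) * t) * k t.
have [mk k2] := Lk.
pose S := \int[mu]_(t in D) (k t ^+ 2).
(* Used with e = exp(-t) to integrate exp(-t) k(t), and with e = exp(b - t) for t > b in the bound
   on q(b). *)
have bound (e y : R) : 0 <= e -> e <= 1 -> e * `|y| <= e + y ^+ 2.
  move=> e0 e1; rewrite -[y ^+ 2]real_normK ?num_real//.
  have := normr_ge0 y; move: `|y| => z z0; have := sqr_ge0 (z - 1).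
  have : e * z ^+ 2 <= z ^+ 2 by rewrite ler_piMl ?sqr_ge0.
  nra.
have hi : mu.-integrable D (EFin \o h).
  apply: (@le_integrableR _ _ _ (fun t => expR (-1 * t) + k t ^+ 2)) => //.
  - apply: measurable_funM => //.
    by apply: measurable_funTS; exact: continuous_measurable_fun.
  - move=> x; rewrite halflineE => x0; rewrite /h normrM ger0_norm ?expR_ge0//.
    have e1 : expR (-1 * x) <= 1 by rewrite -[leRHS]expR0 ler_expR mulN1r oppr_le0 ltW.
    by apply: bound => //; exact: expR_ge0.
  - exact: integrableRD.
exists (- \int[mu]_(t in D) h t).
have [q qE [cq q0]] := @ode_solution 1 (- \int[mu]_(t in D) h t) k ki.
exists q => //.
(* For this initial value, q(b) is -exp(b) times the integral of exp(-t) k(t) over ]b, +oo[. A bound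
   uniform in b is what the energy estimate requires, since q(b)^2 has the unfavourable sign for s =
   1. *)
have qb b : 0 < b -> `|q b| <= 1 + S.
  move=> b0.
  have bD : `]b, +oo[%classic `<=` D.
    by move=> x; rewrite halflineE/= in_itv/= andbT; exact: lt_trans.
  have hb : mu.-integrable `]b, +oo[ (EFin \o h) by exact: integrableS hi.
  have Eb : mu.-integrable `]b, +oo[ (EFin \o (fun t : R => expR (-1 * t))).
    exact: integrableS ED.
  have kb : mu.-integrable `]b, +oo[ (EFin \o (fun t : R => k t ^+ 2)).
    exact: integrableS k2.
  rewrite q0 ?(ltW b0)// /prim -/h addrC -opprB mulrN normrN.
  rewrite Rintegral_itvB ?bnd_simp//; last exact: ltW.
  rewrite normrM ger0_norm ?expR_ge0// mul1r.
  apply: (@le_trans _ _ (expR b * \int[mu]_(t in `]b, +oo[) `|h t|)).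
    by rewrite ler_wpM2l ?expR_ge0// le_normr_Rintegral.
  rewrite -RintegralZl//; last exact: integrable_norm.
  apply: (@le_trans _ _
      (\int[mu]_(t in `]b, +oo[) (expR b * expR (-1 * t) + k t ^+ 2))).
    apply: le_Rintegral => //.
    - by apply: integrableRZ => //; exact: integrable_norm.
    - by apply: integrableRD => //; exact: integrableRZ.
    move=> t; rewrite /= in_itv/= andbT => bt.
    rewrite /h normrM (ger0_norm (expR_ge0 _)) mulrA -expRD.
    apply: bound; first exact: expR_ge0.
    by rewrite -[leRHS]expR0 ler_expR mulN1r subr_le0 ltW.
  rewrite RintegralD//; last exact: integrableRZ.
  rewrite RintegralZl//; apply: lerD; last first.
    by apply: Rintegral_subset => // x _; exact: sqr_ge0.
  rewrite -(@Rintegral_itvB _ _ (BRight 0)) ?bnd_simp//; last exact: ltW.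
  apply: (@le_trans _ _ (expR b * expR (-1 * b))); last first.
    by rewrite -expRD mulN1r subrr expR0.
  by rewrite ler_wpM2l ?expR_ge0// EI// lerBlDr addrC subrK.
apply: (@continuous_sqint _ ((1 + S) ^+ 2 + S)) => // b b0.
have := @ode_energy_le 1 k q b (or_introl erefl) Lk cq.
have := ode_energy ki cq qE b.
have : q b ^+ 2 <= (1 + S) ^+ 2.
  have S0 : 0 <= 1 + S by rewrite (le_trans _ (qb b b0)).
  by rewrite -[q b ^+ 2]real_normK ?num_real// lerXn2r ?nnegrE// qb.
have := sqr_ge0 (\int[mu]_(t in D) h t).
rewrite -/S; lra.
Qed.

End FirstOrderODE.

(** * Complex-valued functions *)

Section ComplexHalfLine.
Variable R : realType.
Local Notation mu := (@lebesgue_measure R).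
Local Notation D := (@halfline R).
Implicit Types (f g h : R -> R[i]) (c d : R[i]).
Let mD : @measurable _ (measurableTypeR R) D := @halfline_measurable R.

Lemma complex_eqP (x y : R[i]) : Re x = Re y -> Im x = Im y -> x = y.
Proof. by case: x y => [a b] [c d] /= -> ->. Qed.

Lemma L2E f : L2 f <-> sqint (fun x => Re (f x)) /\ sqint (fun x => Im (f x)).
Proof.
split=> [[m1 m2 i]|[[m1 i1] [m2 i2]]].
  have H (u : R -> R) : measurable_fun D u ->
      (forall x, u x ^+ 2 <= Re (f x) ^+ 2 + Im (f x) ^+ 2) -> sqint u.
    move=> mu_ ule; split=> //; apply/integrableP; split.
      by apply/measurable_EFinP; exact: measurable_funX.
    apply: le_lt_trans i; apply: ge0_le_integral => //.
    - apply/measurable_EFinP; apply: measurableT_comp => //; exact: measurable_funX.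
    - by apply/measurable_EFinP; apply: measurable_funD; exact: measurable_funX.
    - by move=> x _ /=; rewrite lee_fin ger0_norm ?sqr_ge0.
  split; apply: H => // x; first by rewrite lerDl sqr_ge0.
  by rewrite lerDr sqr_ge0.
split=> //; have /integrableP[_] := integrableRD mD i1 i2; apply: le_lt_trans.
rewrite le_eqVlt; apply/orP; left; apply/eqP; apply: eq_integral => x _.
by rewrite /= ger0_norm// addr_ge0// sqr_ge0.
Qed.

Lemma cintegral_real_mul (phi : R -> R) f :
  cintegral (fun x => (phi x)%:C * f x) =
  (\int[mu]_(x in D) (phi x * Re (f x))) +i* (\int[mu]_(x in D) (phi x * Im (f x))).
Proof.
rewrite /cintegral; congr (_ +i* _); apply: eq_Rintegral => x _.
  by rewrite Defs.ReM/= mul0r subr0.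
by rewrite Defs.ImM/= mul0r addr0.
Qed.

Lemma distr_deriv1E f g : distr_deriv 1 f g <->
  wderiv (fun x => Re (f x)) (fun x => Re (g x)) /\
  wderiv (fun x => Im (f x)) (fun x => Im (g x)).
Proof.
split=> [H|[H1 H2] phi tphi]; last first.
  by rewrite !cintegral_real_mul expr1 mulN1r (H1 _ tphi) (H2 _ tphi).
split=> phi tphi; have := H phi tphi;
  by rewrite !cintegral_real_mul expr1 mulN1r => -[].
Qed.

Definition cprim c f (x : R) : R[i] :=
  prim (Re c) (fun t => Re (f t)) x +i* prim (Im c) (fun t => Im (f t)) x.

Lemma L2_intloc f : L2 f ->
  intloc (fun x => Re (f x)) /\ intloc (fun x => Im (f x)).
Proof. by move=> /L2E[/sqint_intloc f1 /sqint_intloc f2]. Qed.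

Lemma cprim_distr_deriv c f : L2 f -> distr_deriv 1 (cprim c f) f.
Proof.
by move=> /L2_intloc[f1 f2]; apply/distr_deriv1E; split; exact: prim_wderiv.
Qed.

Lemma ae_complex f g : ae_eq mu D (fun x => Re (f x)) (fun x => Re (g x)) ->
  ae_eq mu D (fun x => Im (f x)) (fun x => Im (g x)) -> ae_eq mu D f g.
Proof.
by move=> H1 H2; apply: filterS2 H1 H2 => x H1 H2 Dx; apply: complex_eqP; auto.
Qed.

Lemma ae_ReIm f g : ae_eq mu D f g ->
  ae_eq mu D (fun x => Re (f x)) (fun x => Re (g x)) /\
  ae_eq mu D (fun x => Im (f x)) (fun x => Im (g x)).
Proof. by move=> H; split; apply: filterS H => x H Dx; rewrite H. Qed.

Lemma distr_deriv_cprim f g : loc_integrable f -> L2 g -> distr_deriv 1 f g ->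
  exists c, ae_eq mu D f (cprim c g).
Proof.
move=> [f1 f2] /L2_intloc[g1 g2] /distr_deriv1E[d1 d2].
have [a aP] := wderiv_prim f1 g1 d1; have [b bP] := wderiv_prim f2 g2 d2.
by exists (a +i* b); apply: ae_complex.
Qed.

Lemma cprim_ae_inj c d f g : L2 f -> L2 g ->
  ae_eq mu D (cprim c f) (cprim d g) -> c = d /\ ae_eq mu D f g.
Proof.
move=> /L2_intloc[f1 f2] /L2_intloc[g1 g2] /ae_ReIm[/= H1 H2].
have [c1 e1] := prim_ae_inj f1 g1 H1; have [c2 e2] := prim_ae_inj f2 g2 H2.
by split; [exact: complex_eqP|exact: ae_complex].
Qed.

(** Both derivatives present f as a primitive, and primitives determine their integrand. *)
Lemma distr_deriv_unique f g h : loc_integrable f -> L2 g -> L2 h ->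
  distr_deriv 1 f g -> distr_deriv 1 f h -> ae_eq mu D g h.
Proof.
move=> lf Lg Lh fg fh.
have [c cP] := distr_deriv_cprim lf Lg fg.
have [d dP] := distr_deriv_cprim lf Lh fh.
apply: proj2 (cprim_ae_inj Lg Lh _) => //.
exact: ae_eq_trans (ae_eq_sym cP) dP.
Qed.

Lemma cprim_trace c f : L2 f -> has_trace (cprim c f) c.
Proof.
move=> /L2_intloc[f1 f2]; exists (cprim c f); split => //.
- exact: ae_eq_refl.
- by move=> x _; split; exact: prim_continuous.
- rewrite -[X in _ --> X](@prim_le0 _ _ (fun t => Re (f t)) 0)//.
  by apply: cvg_at_right_filter; exact: prim_continuous.
- rewrite -[X in _ --> X](@prim_le0 _ _ (fun t => Im (f t)) 0)//.
  by apply: cvg_at_right_filter; exact: prim_continuous.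
Qed.

Lemma has_trace_ae f g c : ae_eq mu D f g -> has_trace g c -> has_trace f c.
Proof.
move=> fg [g' [gg' cg g1 g2]]; exists g'; split => //.
exact: ae_eq_trans fg gg'.
Qed.

(** The two continuous representatives agree almost everywhere, hence everywhere on ]0, +oo[, and
    have the same limit at 0. *)
Lemma has_trace_unique f c d : has_trace f c -> has_trace f d -> c = d.
Proof.
move=> [g [fg cg gc gc']] [h [fh ch hd hd']].
have /ae_ReIm[H1 H2] := ae_eq_trans (ae_eq_sym fg) fh.
have key (u v : R -> R) (a b : R) : (forall x, D x -> {for x, continuous u}) ->
    (forall x, D x -> {for x, continuous v}) -> ae_eq mu D u v ->
    u x @[x --> 0^'+] --> a -> v x @[x --> 0^'+] --> b -> a = b.
  move=> cu cv uv ua vb.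
  have E x : 0 < x -> u x = v x.
    move=> x0; apply/eqP; rewrite -subr_eq0; apply/eqP.
    apply: (@continuous_ae0 _ (fun x => u x - v x)) => //.
    - by move=> y y0; apply: cvgB; [apply: cu|apply: cv]; rewrite halflineE.
    - apply: (@filterS _ _ (ae_filter_ringOfSetsType mu)) uv => y uv Dy /=.
      by rewrite uv ?subrr.
  have uv' : \forall x \near 0^'+, v x = u x.
    by near=> x; rewrite E//; near: x; exact: nbhs_right_gt.
  exact: (@cvg_unique R (@Rhausdorff R) _ _ _ _ ua (cvg_trans (near_eq_cvg uv') vb)).
apply: complex_eqP.
- by apply: key gc hd => // x Dx; [have [] := cg x Dx|have [] := ch x Dx].
- by apply: key gc' hd' => // x Dx; [have [] := cg x Dx|have [] := ch x Dx].
Unshelve. all: by end_near. Qed.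

Lemma distr_deriv_ae k f f' g g' : loc_integrable f -> loc_integrable f' ->
  loc_integrable g -> loc_integrable g' ->
  ae_eq mu D f f' -> ae_eq mu D g g' -> distr_deriv k f g -> distr_deriv k f' g'.
Proof.
move=> lf lf' lg lg' ff' gg' fg phi tphi; have := fg phi tphi.
have E n u v : loc_integrable u -> loc_integrable v -> ae_eq mu D u v ->
    cintegral (fun x => (derive1n n phi x)%:C * u x) =
    cintegral (fun x => (derive1n n phi x)%:C * v x).
  move=> lu lv uv.
  have [iu1 iu2] := test_cintegrable n tphi lu.
  have [iv1 iv2] := test_cintegrable n tphi lv.
  rewrite /cintegral /Rintegral; congr (_ +i* _); congr fine;
    apply: ae_eq_integral => //; try exact: (measurable_int mu);
    by apply: filterS uv => x uv Dx; rewrite uv.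
by rewrite (E k f f')// (E 0 g g').
Qed.

Lemma test_function_derive (phi : R -> R) : test_function phi ->
  test_function (fun x => derive1n 1 phi x).
Proof.
move=> [dphi [a [b [a0 phi0]]]]; split.
  by move=> n x; have := dphi n.+1 x; rewrite derive1Sn.
by exists a, b; split => // x; exact: derive1n_support.
Qed.

(** The derivative of a test function is a test function. The second derivative of u thus becomes
    the first derivative of w = u', and only first-order theory is needed. *)
Lemma distr_deriv2E u w h : distr_deriv 1 u w ->
  distr_deriv 2 u h <-> distr_deriv 1 w h.
Proof.
move=> uw.
have E phi : test_function phi ->
    cintegral (fun x => (derive1n 2 phi x)%:C * u x) =
    - cintegral (fun x => (derive1n 1 phi x)%:C * w x).
  by move=> tphi; have := uw _ (test_function_derive tphi); rewrite expr1 mulN1r.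
split=> H phi tphi; have := H phi tphi; rewrite E// expr1 mulN1r sqrrN expr1n mul1r.
  by move=> <-; rewrite opprK.
by move=> ->; rewrite opprK.
Qed.

End ComplexHalfLine.

(** * The L^2 form on an edge and on the graph *)

Section L2Form.
Variable R : realType.
Local Notation mu := (@lebesgue_measure R).
Local Notation D := (@halfline R).
Implicit Types (f g h : R -> R[i]) (c d : R[i]).
Let mD : @measurable _ (measurableTypeR R) D := @halfline_measurable R.

Definition cip f g : R[i] := cintegral (fun x => f x * (g x)^*%C).

Lemma Re_mul_conj (x y : R[i]) : Re (x * (y^*)%C) = Re x * Re y + Im x * Im y.
Proof. by case: x y => [a b] [c d] /=; ring. Qed.

Lemma Im_mul_conj (x y : R[i]) : Im (x * (y^*)%C) = Im x * Re y - Re x * Im y.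
Proof. by case: x y => [a b] [c d] /=; ring. Qed.

Lemma cintegrable_mul_conj f g : L2 f -> L2 g ->
  cintegrable (fun x => f x * (g x)^*%C).
Proof.
move=> /L2E[f1 f2] /L2E[g1 g2]; split.
- apply: (@eq_integrableR _ _ (fun x => Re (f x) * Re (g x) + Im (f x) * Im (g x))) => //.
    by move=> x _; rewrite Re_mul_conj.
  by apply: integrableRD => //; exact: sqintM.
- apply: (@eq_integrableR _ _ (fun x => Im (f x) * Re (g x) - Re (f x) * Im (g x))) => //.
    by move=> x _; rewrite Im_mul_conj.
  by apply: integrableRB => //; exact: sqintM.
Qed.

Lemma Re_cip f g :
  Re (cip f g) = \int[mu]_(x in D) (Re (f x) * Re (g x) + Im (f x) * Im (g x)).
Proof. by apply: eq_Rintegral => x _; rewrite Re_mul_conj. Qed.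

Lemma cip_linl c f f' g : L2 f -> L2 f' -> L2 g ->
  cip (fun x => c * f x + f' x) g = c * cip f g + cip f' g.
Proof.
move=> Lf Lf' Lg.
have [_ <-] := cintegrable_lin c (cintegrable_mul_conj Lf Lg) (cintegrable_mul_conj Lf' Lg).
by congr cintegral; apply/funext => x; rewrite mulrDl mulrA.
Qed.

Lemma cip_conj f g : L2 f -> L2 g -> cip g f = (cip f g)^*%C.
Proof.
move=> Lf Lg; have [_ i] := cintegrable_mul_conj Lf Lg.
apply: complex_eqP => /=.
- by apply: eq_Rintegral => x _; rewrite !Re_mul_conj; ring.
- rewrite -mulN1r -RintegralZl//; apply: eq_Rintegral => x _.
  by rewrite !Im_mul_conj; ring.
Qed.

Lemma cip_ae f f' g g' : L2 f -> L2 f' -> L2 g -> L2 g' ->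
  ae_eq mu D f f' -> ae_eq mu D g g' -> cip f g = cip f' g'.
Proof.
move=> Lf Lf' Lg Lg' ff' gg'.
have [i1 i2] := cintegrable_mul_conj Lf Lg.
have [i1' i2'] := cintegrable_mul_conj Lf' Lg'.
rewrite /cip /cintegral /Rintegral; congr (_ +i* _); congr fine;
  apply: ae_eq_integral => //; try exact: (measurable_int mu);
  by apply: filterS2 ff' gg' => x ff' gg' Dx; rewrite ff'// gg'.
Qed.

Lemma Re_cip_ge0 f : 0 <= Re (cip f f).
Proof. by rewrite Re_cip; apply: Rintegral_ge0 => x _; rewrite addr_ge0// -expr2 sqr_ge0. Qed.

Lemma Re_cip_eq0 f : L2 f -> Re (cip f f) = 0 -> ae_eq mu D f (cst 0).
Proof.
move=> /L2E[f1 f2]; rewrite Re_cip => f0.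
have i : mu.-integrable D
    (EFin \o (fun x => Re (f x) * Re (f x) + Im (f x) * Im (f x))).
  by apply: integrableRD => //; exact: sqintM.
have p x : 0 <= Re (f x) * Re (f x) + Im (f x) * Im (f x).
  by rewrite addr_ge0// -expr2 sqr_ge0.
have : (\int[mu]_(x in D) `|(Re (f x) * Re (f x) + Im (f x) * Im (f x))%:E| = 0)%E.
  under eq_integral do rewrite /= ger0_norm//.
  by rewrite EFin_Rintegral// f0.
move=> /ae_eq_integral_abs H.
have {}H := H mD (measurable_int mu i).
apply: filterS H => x /= + Dx => /(_ Dx) [/eqP].
rewrite paddr_eq0 ?mulf_eq0 -?expr2 ?sqr_ge0// !orbb => /andP[/eqP a /eqP b].
exact: complex_eqP.
Qed.

End L2Form.

Section GraphForm.
Variables (R : realType) (N : nat).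
Local Notation mu := (@lebesgue_measure R).
Local Notation D := (@halfline R).
Implicit Types (u v w : graph_fun R N).

Lemma in_L2_lin (c : R[i]) u v : in_L2 u -> in_L2 v -> in_L2 (c *: u + v).
Proof. by move=> Lu Lv j; exact: L2_lin. Qed.

Lemma L2_form_linl c u u' v : in_L2 u -> in_L2 u' -> in_L2 v ->
  L2_form (c *: u + u') v = c * L2_form u v + L2_form u' v.
Proof.
move=> Lu Lu' Lv; rewrite /L2_form mulr_sumr -big_split/=.
by apply: eq_bigr => j _; exact: cip_linl.
Qed.

Lemma L2_form_conj u v : in_L2 u -> in_L2 v -> L2_form v u = (L2_form u v)^*%C.
Proof.
move=> Lu Lv; rewrite /L2_form rmorph_sum/=.
by apply: eq_bigr => j _; exact: cip_conj.
Qed.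

Lemma L2_form_ae u u' v v' : in_L2 u -> in_L2 u' -> in_L2 v -> in_L2 v' ->
  (forall j, ae_eq mu D (u j) (u' j)) -> (forall j, ae_eq mu D (v j) (v' j)) ->
  L2_form u v = L2_form u' v'.
Proof. by move=> Lu Lu' Lv Lv' uu' vv'; apply: eq_bigr => j _; exact: cip_ae. Qed.

Lemma Re_sum (I : finType) (F : I -> R[i]) : Re (\sum_i F i) = \sum_i Re (F i).
Proof. by apply: (big_morph Re) => // x y; exact: Defs.ReD. Qed.

Lemma Re_L2_form_ge0 u : 0 <= Re (L2_form u u).
Proof. by rewrite Re_sum; apply: sumr_ge0 => j _; exact: Re_cip_ge0. Qed.

Lemma Re_L2_form_eq0 u : in_L2 u -> Re (L2_form u u) = 0 ->
  forall j, ae_eq mu D (u j) (cst 0).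
Proof.
move=> Lu; rewrite Re_sum => /psumr_eq0P H j; apply: Re_cip_eq0 => //.
by apply: H => // i _; exact: Re_cip_ge0.
Qed.

End GraphForm.

(** * The energy space *)

Section EnergySpace.
Variables (R : realType) (N : nat).
Local Notation mu := (@lebesgue_measure R).
Local Notation D := (@halfline R).
Implicit Types (u v w : graph_fun R N) (a : H1tilde R N) (b : L2space R N)
  (U V W : energy_space R N) (c : R[i]).

Lemma in_H1dot_lin c u v : in_H1dot u -> in_H1dot v -> in_H1dot (c *: u + v).
Proof.
move=> [Hu [d ud]] [Hv [e ve]]; split; first by move=> j; exact: Hdot_lin.
by exists (c * d + e) => j; exact: has_trace_lin.
Qed.

Lemma H1dot_insubdK u : in_H1dot u -> H1dot_val (insubd (0 : H1dot_fun R N) u) = u.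
Proof. by move=> Hu; apply: (@insubdK _ _ (H1dot_fun R N)); exact/asboolP. Qed.

Lemma L2_insubdK v : in_L2 v -> L2_val (insubd (0 : L2_fun R N) v) = v.
Proof. by move=> Hv; apply: (@insubdK _ _ (L2_fun R N)); exact/asboolP. Qed.

Lemma H1tilde_class_lin c u v : in_H1dot u -> in_H1dot v ->
  H1tilde_class (c *: u + v) = c *: H1tilde_class u + H1tilde_class v.
Proof.
move=> Hu Hv; rewrite /H1tilde_class.
have -> : insubd (0 : H1dot_fun R N) (c *: u + v) =
    c *: insubd (0 : H1dot_fun R N) u + insubd (0 : H1dot_fun R N) v.
  apply: val_inj; rewrite /= H1dot_insubdK; last exact: in_H1dot_lin.
  by rewrite -[in LHS](H1dot_insubdK Hu) -[in LHS](H1dot_insubdK Hv).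
rewrite -[RHS]/(lmod_quot_scale c _ + _) lmod_quot_piZ.
by rewrite lmod_quot_piD.
Qed.

Lemma L2_class_lin c u v : in_L2 u -> in_L2 v ->
  L2_class (c *: u + v) = c *: L2_class u + L2_class v.
Proof.
move=> Hu Hv; rewrite /L2_class.
have -> : insubd (0 : L2_fun R N) (c *: u + v) =
    c *: insubd (0 : L2_fun R N) u + insubd (0 : L2_fun R N) v.
  apply: val_inj; rewrite /= L2_insubdK; last exact: in_L2_lin.
  by rewrite -[in LHS](L2_insubdK Hu) -[in LHS](L2_insubdK Hv).
rewrite -[RHS]/(lmod_quot_scale c _ + _) lmod_quot_piZ.
by rewrite lmod_quot_piD.
Qed.

Lemma H1tilde_class_eqP u v : in_H1dot u -> in_H1dot v ->
  H1tilde_class u = H1tilde_class v <->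
  exists c, forall j, ae_eq mu D (fun x => u j x - v j x) (cst c).
Proof.
move=> Hu Hv; rewrite /H1tilde_class.
have E : H1dot_val (insubd (0 : H1dot_fun R N) u - insubd (0 : H1dot_fun R N) v) = u - v.
  by rewrite -[in RHS](H1dot_insubdK Hu) -[in RHS](H1dot_insubdK Hv).
split=> [/lmod_quot_piE/asboolP|H]; first by rewrite E.
by apply/lmod_quot_piE/asboolP; rewrite E.
Qed.

Lemma L2_class_eqP u v : in_L2 u -> in_L2 v ->
  L2_class u = L2_class v <-> forall j, ae_eq mu D (u j) (v j).
Proof.
move=> Hu Hv; rewrite /L2_class.
have E : L2_val (insubd (0 : L2_fun R N) u - insubd (0 : L2_fun R N) v) = u - v.
  by rewrite -[in RHS](L2_insubdK Hu) -[in RHS](L2_insubdK Hv).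
split=> [/lmod_quot_piE/asboolP|H].
  rewrite E => H j; apply: filterS (H j) => x + Dx => /(_ Dx) uv.
  by apply/eqP; rewrite -subr_eq0; apply/eqP.
apply/lmod_quot_piE/asboolP; rewrite E => j.
apply: filterS (H j) => x + Dx => /(_ Dx) uv.
by rewrite /= -[LHS]/(u j x - v j x) uv subrr.
Qed.

Lemma H1tilde_repr a : in_H1dot (H1dot_val (repr a)) /\
  H1tilde_class (H1dot_val (repr a)) = a.
Proof.
split; first exact/asboolP/H1dot_valP.
rewrite /H1tilde_class -[RHS]reprK; congr (\pi_(H1tilde R N) _).
exact: valKd.
Qed.

Lemma L2_repr b : in_L2 (L2_val (repr b)) /\ L2_class (L2_val (repr b)) = b.
Proof.
split; first exact/asboolP/L2_valP.
rewrite /L2_class -[RHS]reprK; congr (\pi_(L2space R N) _).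
exact: valKd.
Qed.

Definition graph_distr u w := forall j, distr_deriv 1 (u j) (w j).

Lemma in_H1dot_deriv u : in_H1dot u ->
  in_L2 (graph_deriv 1 u) /\ graph_distr u (graph_deriv 1 u).
Proof.
move=> [Hu _].
have H j : L2 (graph_deriv 1 u j) /\ distr_deriv 1 (u j) (graph_deriv 1 u j).
  have [_ [g Lg ug]] := Hu j.
  by apply: (@xgetPex _ (fun=> 0) [set g | L2 g /\ distr_deriv 1 (u j) g]); exists g.
by split=> j; have [] := H j.
Qed.

Lemma in_H1dot_loc u j : in_H1dot u -> loc_integrable (u j).
Proof. by move=> [Hu _]; have [] := Hu j. Qed.

Lemma loc_integrable_cst c : loc_integrable (fun=> c : R[i]).
Proof.
have H (d : R) : locally_integrable D (fun=> d).
  split; [exact: measurable_cst|exact: halfline_open|].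
  move=> K KD cK.
  have : mu.-integrable K (EFin \o (cst d : R -> R)).
    apply: continuous_compact_integrable => //.
    by apply: continuous_subspaceT => x; exact: cvg_cst.
  by move=> /integrableP[].
by split; exact: H.
Qed.

Lemma L2_cst0 : L2 (fun=> 0 : R[i]).
Proof. by apply: L2_0. Qed.

Lemma cprim_cst c : cprim c (fun=> 0 : R[i]) = (fun=> c).
Proof.
have Z (d t : R) : prim d (fun=> 0) t = d.
  by rewrite /prim /Rintegral integral0_eq ?addr0.
by apply/funext => t; rewrite /cprim/= !Z; case: c.
Qed.

Lemma distr_deriv_cst c : distr_deriv 1 (fun=> c : R[i]) (fun=> 0).
Proof. by rewrite -cprim_cst; exact: cprim_distr_deriv L2_cst0. Qed.

(** Two representatives differ by a constant, whose weak derivative is 0. *)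
Lemma graph_distr_class u v w : in_H1dot u -> in_H1dot v ->
  H1tilde_class u = H1tilde_class v -> in_L2 w -> graph_distr u w -> graph_distr v w.
Proof.
move=> Hu Hv /(H1tilde_class_eqP Hu Hv)[c cP] Lw uw j.
have lu := in_H1dot_loc j Hu; have lv := in_H1dot_loc j Hv.
have lw := L2_loc_integrable (Lw j).
have l0 := loc_integrable_cst 0.
have lc := loc_integrable_cst c.
have := @distr_deriv_lin R 1 (-1) _ _ _ _ lc lu l0 lw (distr_deriv_cst c) (uw j).
apply: distr_deriv_ae => //; try exact: loc_integrable_lin.
- apply: filterS (cP j) => x + Dx => /(_ Dx) /= <-.
  by rewrite mulN1r opprB subrK.
- by apply: nearW => x Dx /=; rewrite mulr0 add0r.
Qed.

(** [energy_ip] goes through [repr] and the derivative picked by [xget]; here it is computed from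
    arbitrary representatives and arbitrary weak derivatives. *)
Lemma energy_ipE u u' w w' v v' : in_H1dot u -> in_H1dot u' -> in_L2 v -> in_L2 v' ->
  in_L2 w -> in_L2 w' -> graph_distr u w -> graph_distr u' w' ->
  energy_ip (H1tilde_class u, L2_class v) (H1tilde_class u', L2_class v') =
  L2_form w w' + L2_form v v'.
Proof.
move=> Hu Hu' Lv Lv' Lw Lw' uw uw'; rewrite /energy_ip/=.
have H1 f h : in_H1dot f -> in_L2 h -> graph_distr f h ->
    let d := graph_deriv 1 (H1dot_val (repr (H1tilde_class f))) in
    in_L2 d /\ forall j, ae_eq mu D (d j) (h j).
  move=> Hf Lh fh; have [Hr rE] := H1tilde_repr (H1tilde_class f).
  have [Ld rd] := in_H1dot_deriv Hr; split=> // j.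
  have rh := graph_distr_class Hf Hr (esym rE) Lh fh.
  exact: distr_deriv_unique (in_H1dot_loc j Hr) (Ld j) (Lh j) (rd j) (rh j).
have H2 (f : graph_fun R N) : in_L2 f -> in_L2 (L2_val (repr (L2_class f))) /\
    forall j, ae_eq mu D (L2_val (repr (L2_class f)) j) (f j).
  move=> Lf; have [Lr rE] := L2_repr (L2_class f); split=> //.
  exact/(L2_class_eqP Lr Lf).
have [L1 E1] := H1 _ _ Hu Lw uw; have [L1' E1'] := H1 _ _ Hu' Lw' uw'.
have [K E] := H2 _ Lv; have [K' E'] := H2 _ Lv'.
by rewrite (L2_form_ae L1 Lw L1' Lw')// (L2_form_ae K Lv K' Lv').
Qed.

Lemma energy_spaceP U : exists u v w,
  [/\ in_H1dot u, in_L2 v, in_L2 w, graph_distr u w & U = (H1tilde_class u, L2_class v)].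
Proof.
case: U => x y; have [Hu ux] := H1tilde_repr x; have [Lv vy] := L2_repr y.
have [Lw uw] := in_H1dot_deriv Hu.
exists (H1dot_val (repr x)), (L2_val (repr y)), (graph_deriv 1 (H1dot_val (repr x))).
by split=> //; rewrite ux vy.
Qed.

Lemma graph_distr_lin c u u' w w' : in_H1dot u -> in_H1dot u' -> in_L2 w -> in_L2 w' ->
  graph_distr u w -> graph_distr u' w' -> graph_distr (c *: u + u') (c *: w + w').
Proof.
move=> Hu Hu' Lw Lw' uw uw' j.
by apply: distr_deriv_lin => //; (exact: in_H1dot_loc || exact: L2_loc_integrable).
Qed.

Lemma class_lin c u u' v v' : in_H1dot u -> in_H1dot u' -> in_L2 v -> in_L2 v' ->
  c *: ((H1tilde_class u, L2_class v) : energy_space R N) + (H1tilde_class u', L2_class v')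
  = (H1tilde_class (c *: u + u'), L2_class (c *: v + v')).
Proof. by move=> Hu Hu' Lv Lv'; rewrite H1tilde_class_lin// L2_class_lin. Qed.

Lemma energy_ip_linl c U U' V :
  energy_ip (c *: U + U') V = c * energy_ip U V + energy_ip U' V.
Proof.
have [u [v [w [Hu Lv Lw uw ->]]]] := energy_spaceP U.
have [u' [v' [w' [Hu' Lv' Lw' uw' ->]]]] := energy_spaceP U'.
have [f [g [h [Hf Lg Lh fh ->]]]] := energy_spaceP V.
rewrite class_lin// (energy_ipE (w := c *: w + w') (w' := h))//; first last.
- exact: graph_distr_lin.
- exact: in_L2_lin.
- exact: in_L2_lin.
- exact: in_H1dot_lin.
rewrite (energy_ipE (w := w) (w' := h))// (energy_ipE (w := w') (w' := h))//.
by rewrite !L2_form_linl// mulrDr addrACA.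
Qed.

Lemma energy_ip_conj U V : energy_ip V U = (energy_ip U V)^*%C.
Proof.
have [u [v [w [Hu Lv Lw uw ->]]]] := energy_spaceP U.
have [f [g [h [Hf Lg Lh fh ->]]]] := energy_spaceP V.
rewrite (energy_ipE Hf Hu Lg Lv Lh Lw fh uw) (energy_ipE Hu Hf Lv Lg Lw Lh uw fh).
by rewrite (L2_form_conj Lw)// (L2_form_conj Lv)// rmorphD.
Qed.

Lemma energy_ip_ge0 U : 0 <= Re (energy_ip U U).
Proof. by rewrite /energy_ip Defs.ReD addr_ge0// Re_L2_form_ge0. Qed.

Lemma in_H1dot0 : in_H1dot (0 : graph_fun R N).
Proof. by split=> [j|]; [exact: Hdot_0|exists 0 => j; exact: has_trace_0]. Qed.

Lemma in_L20 : in_L2 (0 : graph_fun R N).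
Proof. by move=> j; exact: L2_0. Qed.

Lemma H1tilde_class0 : H1tilde_class (0 : graph_fun R N) = 0.
Proof.
have := H1tilde_class_lin (-1) in_H1dot0 in_H1dot0.
by rewrite scaler0 addr0 => ->; rewrite scaleN1r addNr.
Qed.

Lemma L2_class0 : L2_class (0 : graph_fun R N) = 0.
Proof.
have := L2_class_lin (-1) in_L20 in_L20.
by rewrite scaler0 addr0 => ->; rewrite scaleN1r addNr.
Qed.

(** A zero derivative makes u constant on each edge; continuity at the vertex makes these constants
    equal, and the quotient removes the common one. *)
Lemma energy_ip_eq0 U : Re (energy_ip U U) = 0 -> U = 0.
Proof.
have [u [v [w [Hu Lv Lw uw ->]]]] := energy_spaceP U.
rewrite (energy_ipE Hu Hu Lv Lv Lw Lw uw uw) Defs.ReD => /eqP.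
rewrite paddr_eq0 ?Re_L2_form_ge0// => /andP[/eqP w0 /eqP v0].
have {}w0 := Re_L2_form_eq0 Lw w0; have {}v0 := Re_L2_form_eq0 Lv v0.
congr (_, _).
- rewrite -H1tilde_class0; apply/(H1tilde_class_eqP Hu in_H1dot0).
  have [_ [c uc]] := Hu; exists c => j.
  have lu := in_H1dot_loc j Hu; have lw := L2_loc_integrable (Lw j).
  have l0 := loc_integrable_cst 0.
  have := distr_deriv_ae lu lu lw l0 (ae_eq_refl _ _ _) (w0 j) (uw j).
  move=> /(distr_deriv_cprim lu L2_cst0)[d].
  rewrite cprim_cst => ud.
  have : has_trace (u j) d.
    by apply: has_trace_ae ud _; rewrite -cprim_cst; exact: cprim_trace L2_cst0.
  move=> /(has_trace_unique (uc j)) ->.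
  by apply: filterS ud => x ud Dx; rewrite subr0 ud.
- by rewrite -L2_class0; apply/(L2_class_eqP Lv in_L20).
Qed.

End EnergySpace.

(** * The wave operator *)

Section WaveData.
Variables (R : realType) (N : nat).
Local Notation mu := (@lebesgue_measure R).
Local Notation D := (@halfline R).
Implicit Types (u v w h z : graph_fun R N) (U V W : energy_space R N) (c alpha : R[i]).
Let mD : @measurable _ (measurableTypeR R) D := @halfline_measurable R.

(* [w = u'], [h = u''], [z = v'], and [d], [c] are the traces of [u'], [v]. *)
Record wave_data alpha u v w h z (d : 'I_N -> R[i]) c : Prop := WaveData {
  wave_u : in_H1dot u;
  wave_v : in_L2 v;
  wave_w : in_L2 w;
  wave_h : in_L2 h;
  wave_z : in_L2 z;
  wave_uw : graph_distr u w;
  wave_wh : graph_distr w h;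
  wave_vz : graph_distr v z;
  wave_vc : forall j, has_trace (v j) c;
  wave_wd : forall j, has_trace (w j) (d j);
  wave_kirchhoff : \sum_(j < N) d j + alpha * c = 0
}.

Lemma graph_distr_in_H1dot v z c : in_L2 v -> in_L2 z -> graph_distr v z ->
  (forall j, has_trace (v j) c) -> in_H1dot v.
Proof.
move=> Lv Lz vz vc; split; last by exists c.
by move=> j; split; [exact: L2_loc_integrable|exists (z j)].
Qed.

Lemma wave_data_v alpha u v w h z d c : wave_data alpha u v w h z d c -> in_H1dot v.
Proof. by case=> *; apply: (@graph_distr_in_H1dot v z c). Qed.

Lemma wave_data_dom alpha u v w h z d c : wave_data alpha u v w h z d c ->
  wave_dom alpha (H1tilde_class u, L2_class v).
Proof.
case=> Hu Lv Lw Lh Lz uw wh vz vc wd E.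
exists u, v; split=> //.
- split=> // j; split; first exact: in_H1dot_loc.
  by exists (h j) => //; apply/(distr_deriv2E _ (uw j)).
- split; last by exists c.
  move=> j; split=> // -[_|[_|//]]; last by exists (z j).
  by exists (v j) => // phi _; rewrite expr0 mul1r.
exists d, c; split=> // j; apply: has_trace_ae (wd j).
have [Lw' uw'] := in_H1dot_deriv Hu.
exact: distr_deriv_unique (in_H1dot_loc j Hu) (Lw' j) (Lw j) (uw' j) (uw j).
Qed.

(** [wave_act] uses chosen representatives: that of the class of v must be shown to lie in the
    H^1-type space again, and the second derivative chosen for that of u to equal h almost
    everywhere. *)
Lemma wave_data_act alpha u v w h z d c : wave_data alpha u v w h z d c ->
  wave_act (H1tilde_class u, L2_class v) = (H1tilde_class v, L2_class h).
Proof.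
move=> wd; have Hv := wave_data_v wd.
case: wd => Hu Lv Lw Lh Lz uw wh vz vc _ _.
rewrite /wave_act/=; congr (_, _).
- have [Lr rE] := L2_repr (L2_class v); set r := L2_val _ in Lr rE *.
  have rv := (L2_class_eqP Lr Lv).1 rE.
  (* Without this membership [H1tilde_class r] would be the class of the default value 0. *)
  have Hr : in_H1dot r.
    apply: (@graph_distr_in_H1dot r z c) => // j.
      have := vz j; apply: distr_deriv_ae; try exact: L2_loc_integrable.
        exact: ae_eq_sym.
      exact: ae_eq_refl.
    exact: has_trace_ae (rv j) (vc j).
  apply/(H1tilde_class_eqP Hr Hv); exists 0 => j.
  by apply: filterS (rv j) => x rv' Dx; rewrite rv' ?subrr.
- have [Hq qE] := H1tilde_repr (H1tilde_class u); set q := H1dot_val _ in Hq qE *.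
  have qw := graph_distr_class Hu Hq (esym qE) Lw uw.
  have H j : L2 (graph_deriv 2 q j) /\ distr_deriv 2 (q j) (graph_deriv 2 q j).
    apply: (@xgetPex _ (fun=> 0) [set g | L2 g /\ distr_deriv 2 (q j) g]).
    by exists (h j); split=> //; apply/(distr_deriv2E _ (qw j)).
  have Lq : in_L2 (graph_deriv 2 q) by move=> j; have [] := H j.
  apply/(L2_class_eqP Lq Lh) => j.
  have [_ /(distr_deriv2E _ (qw j)) wq] := H j.
  exact: distr_deriv_unique (L2_loc_integrable (Lw j)) (Lq j) (Lh j) wq (wh j).
Qed.

Lemma wave_dom_data alpha U : wave_dom alpha U -> exists u v w h z d c,
  wave_data alpha u v w h z d c /\ U = (H1tilde_class u, L2_class v).
Proof.
move=> [u [v [[Hu Hu2] [Hv [c' vc']] -> [d [c [wd vc E]]]]]].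
have [Lw uw] := in_H1dot_deriv Hu.
have /choice[h hP] : forall j, exists g, L2 g /\ distr_deriv 2 (u j) g.
  by move=> j; have [_ [g Lg ug]] := Hu2 j; exists g.
have /choice[z zP] : forall j, exists g, L2 g /\ distr_deriv 1 (v j) g.
  by move=> j; have [_ /(_ 1%N (leqnn 1))[g Lg vg]] := Hv j; exists g.
exists u, v, (graph_deriv 1 u), h, z, d, c; split=> //; split=> //.
- by move=> j; have [] := Hv j.
- by move=> j; have [] := hP j.
- by move=> j; have [] := zP j.
- by move=> j; have [_ /(distr_deriv2E _ (uw j))] := hP j.
- by move=> j; have [] := zP j.
Qed.

Lemma wave_data_lin (a : R[i]) alpha u v w h z d c u' v' w' h' z' d' c' :
  wave_data alpha u v w h z d c -> wave_data alpha u' v' w' h' z' d' c' ->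
  wave_data alpha (a *: u + u') (a *: v + v') (a *: w + w') (a *: h + h')
    (a *: z + z') (fun j => a * d j + d' j) (a * c + c').
Proof.
have L2_lin' f f' g g' : in_L2 f -> in_L2 f' -> in_L2 g -> in_L2 g' ->
    graph_distr f f' -> graph_distr g g' -> graph_distr (a *: f + g) (a *: f' + g').
  move=> Lf Lf' Lg Lg' ff' gg' j.
  by apply: distr_deriv_lin => //; exact: L2_loc_integrable.
case=> Hu Lv Lw Lh Lz uw wh vz vc wd E.
case=> Hu' Lv' Lw' Lh' Lz' uw' wh' vz' vc' wd' E'.
split; [exact: in_H1dot_lin|exact: in_L2_lin..|exact: graph_distr_lin
  |exact: L2_lin'|exact: L2_lin'| | |].
- by move=> j; exact: has_trace_lin.
- by move=> j; exact: has_trace_lin.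
- rewrite big_split/= -mulr_sumr mulrDr addrACA mulrCA -mulrDr E E'.
  by rewrite mulr0 addr0.
Qed.

Lemma sqint_ae (f g : R -> R) : sqint f -> measurable_fun D g -> ae_eq mu D f g ->
  sqint g.
Proof.
move=> [mf f2] mg fg; split=> //; apply/integrableP; split.
  by apply/measurable_EFinP; exact: measurable_funX.
have /integrableP[_] := f2; apply: le_lt_trans.
rewrite le_eqVlt; apply/orP; left; apply/eqP; apply: ae_eq_integral => //.
- apply: measurableT_comp => //; apply/measurable_EFinP; exact: measurable_funX.
- apply: measurableT_comp => //; apply/measurable_EFinP; exact: measurable_funX.
- by apply: filterS fg => x fg Dx /=; rewrite fg.
Qed.

(** Integration by parts is stated for primitives, so square integrability is passed to the
    continuous representative. *)
Lemma L2_cprim c f (g : R -> R[i]) : L2 f -> L2 g -> ae_eq mu D f (cprim c g) ->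
  L2 (cprim c g).
Proof.
move=> /L2E[f1 f2] /L2_intloc[g1 g2] /ae_ReIm[fg1 fg2]; apply/L2E.
by split; [apply: sqint_ae f1 _ fg1|apply: sqint_ae f2 _ fg2]; exact: prim_measurable.
Qed.

Lemma distr_deriv_cprim_trace f (g : R -> R[i]) c : L2 f -> L2 g ->
  distr_deriv 1 f g -> has_trace f c -> ae_eq mu D f (cprim c g).
Proof.
move=> Lf Lg fg fc.
have [a fa] := distr_deriv_cprim (L2_loc_integrable Lf) Lg fg.
by rewrite (has_trace_unique fc (has_trace_ae fa (cprim_trace a Lg))).
Qed.

(** The real part of v' conj(w) + w' conj(v) is the derivative of Re v Re w + Im v Im w: two real
    integrations by parts, one for each product. *)
Lemma Re_cip_by_parts (v z w h : R -> R[i]) c d : L2 v -> L2 z -> L2 w -> L2 h ->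
  distr_deriv 1 v z -> distr_deriv 1 w h -> has_trace v c -> has_trace w d ->
  Re (cip z w) + Re (cip h v) = - Re (d * (c^*)%C).
Proof.
move=> Lv Lz Lw Lh vz wh vc wd.
have vP := distr_deriv_cprim_trace Lv Lz vz vc.
have wP := distr_deriv_cprim_trace Lw Lh wh wd.
have LV := L2_cprim Lv Lz vP; have LW := L2_cprim Lw Lh wP.
rewrite (cip_ae Lz Lz Lw LW (ae_eq_refl _ _ _) wP).
rewrite (cip_ae Lh Lh Lv LV (ae_eq_refl _ _ _) vP) !Re_cip Re_mul_conj.
have [z1 z2] := (L2E z).1 Lz; have [h1 h2] := (L2E h).1 Lh.
have [v1 v2] := (L2E _).1 LV; have [w1 w2] := (L2E _).1 LW.
have P1 := integration_by_parts_halfline z1 h1 v1 w1.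
have P2 := integration_by_parts_halfline z2 h2 v2 w2.
rewrite -RintegralD//; [|by apply: integrableRD => //; exact: sqintM..].
rewrite opprD mulrC [Im d * _]mulrC -P1 -P2 -RintegralD//;
  [|by apply: integrableRD => //; exact: sqintM..].
by apply: eq_Rintegral => x _ /=; ring.
Qed.

(** The boundary terms add up to -Re(conj(v(0)) sum_j u_j'(0)), and the vertex condition replaces
    the sum by -alpha v(0). *)
Lemma Re_wave_data alpha u v w h z d c : wave_data alpha u v w h z d c ->
  Re (energy_ip (H1tilde_class v, L2_class h) (H1tilde_class u, L2_class v)) =
  Re alpha * (Re c ^+ 2 + Im c ^+ 2).
Proof.
move=> wdata; have Hv := wave_data_v wdata.
case: wdata => Hu Lv Lw Lh Lz uw wh vz vc wd E.
rewrite (energy_ipE Hv Hu Lh Lv Lz Lw vz uw) Defs.ReD !Re_sum -big_split/=.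
transitivity (\sum_(j < N) - Re (d j * (c^*)%C)).
  by apply: eq_bigr => j _; apply: Re_cip_by_parts.
rewrite sumrN -Re_sum -mulr_suml.
have -> : \sum_(j < N) d j = - (alpha * c) by apply/eqP; rewrite -addr_eq0 E.
by case: alpha c {vc wd E} => [a b] [p q] /=; ring.
Qed.

End WaveData.

(** * Solving the equation (W - s) U = F *)

Section LinearCombinations.
Variable R : realType.
Implicit Types (f g : R -> R[i]) (a b c d : R[i]).

Lemma L2_comb a b f g : L2 f -> L2 g -> L2 (fun x => a * f x + b * g x).
Proof.
move=> Lf Lg; have := L2_lin a Lf (L2_lin b Lg (@L2_cst0 R)).
by congr L2; apply/funext => x; rewrite addr0.
Qed.

Lemma has_trace_comb a b f g c d : has_trace f c -> has_trace g d ->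
  has_trace (fun x => a * f x + b * g x) (a * c + b * d).
Proof.
move=> fc gd; have := has_trace_lin a fc (has_trace_lin b gd (@has_trace_0 R)).
rewrite addr0; congr (has_trace _ _).
by apply/funext => x; rewrite addr0.
Qed.

Lemma distr_deriv_comb a b f g f' g' : loc_integrable f -> loc_integrable g ->
  L2 f' -> L2 g' -> distr_deriv 1 f f' -> distr_deriv 1 g g' ->
  distr_deriv 1 (fun x => a * f x + b * g x) (fun x => a * f' x + b * g' x).
Proof.
move=> lf lg Lf' Lg' ff' gg'.
have [lf' lg'] := (L2_loc_integrable Lf', L2_loc_integrable Lg').
have l0 := loc_integrable_cst (0 : R[i]).
have := distr_deriv_lin a lf (loc_integrable_lin b lg l0) lf'
  (loc_integrable_lin b lg' l0) ff'
  (distr_deriv_lin b lg l0 lg' l0 gg' (distr_deriv_cst 0)).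
congr (distr_deriv _ _ _); by apply/funext => x; rewrite addr0.
Qed.

Lemma complex_ode_forward c g : L2 g -> exists f,
  [/\ L2 f, has_trace f c & distr_deriv 1 f (fun x => -1 * f x + g x)].
Proof.
move=> /[dup] Lg /L2E[g1 g2].
have [q1 q1E L1] := ode_forward (Re c) g1.
have [q2 q2E L2'] := ode_forward (Im c) g2.
pose f x := q1 x +i* q2 x.
have Lf : L2 f by apply/L2E.
have Lf' : L2 (fun x => -1 * f x + g x) by exact: L2_lin.
have fE : f = cprim c (fun x => -1 * f x + g x).
  apply/funext => x; rewrite /cprim; apply: complex_eqP => /=.
  - rewrite q1E; apply: eq_prim => t _.
    by rewrite Defs.ReD Defs.ReM /= oppr0 mul0r subr0.
  - rewrite q2E; apply: eq_prim => t _.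
    by rewrite Defs.ImD Defs.ImM /= oppr0 mul0r addr0.
exists f; split=> //; first by rewrite fE; exact: cprim_trace.
by rewrite [X in distr_deriv _ X _]fE; exact: cprim_distr_deriv.
Qed.

Lemma complex_ode_backward g : L2 g -> exists c f,
  [/\ L2 f, has_trace f c & distr_deriv 1 f (fun x => 1 * f x + g x)].
Proof.
move=> /[dup] Lg /L2E[g1 g2].
have [c1 [q1 q1E L1]] := ode_backward g1.
have [c2 [q2 q2E L2']] := ode_backward g2.
pose f x := q1 x +i* q2 x.
have Lf : L2 f by apply/L2E.
have Lf' : L2 (fun x => 1 * f x + g x) by exact: L2_lin.
have fE : f = cprim (c1 +i* c2) (fun x => 1 * f x + g x).
  apply/funext => x; rewrite /cprim; apply: complex_eqP => /=.
  - rewrite q1E; apply: eq_prim => t _.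
    by rewrite Defs.ReD Defs.ReM /= mul0r subr0.
  - rewrite q2E; apply: eq_prim => t _.
    by rewrite Defs.ImD Defs.ImM /= mul0r addr0.
exists (c1 +i* c2), f; split=> //; first by rewrite fE; exact: cprim_trace.
by rewrite [X in distr_deriv _ X _]fE; exact: cprim_distr_deriv.
Qed.

End LinearCombinations.

Section Surjectivity.
Variables (R : realType) (N : nat).
Implicit Types (u v w h z f g : graph_fun R N) (F U V W : energy_space R N)
  (c s alpha : R[i]).

(* The components [p = w + s v] and [q = w - s v] solve the decoupled equations
   [p' = p + (g + s f')] and [q' = - q + (g - s f')]. *)
Lemma wave_surjective alpha s F : (0 < N)%N -> s = 1 \/ s = -1 ->
  Re (s * alpha) <= 0 ->
  exists2 U, wave_dom alpha U & wave_act U - s *: U = F.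
Proof.
move=> N0 hs sa.
have ss : s * s = 1 by case: hs => ->; rewrite ?mulrNN mulr1.
(* [field] is unaware that s^2 = 1; writing a term y as s * s * y turns the identities below into
   formal ones in s. *)
have ss1 (y : R[i]) : y = s * s * y by rewrite ss mul1r.
have [f [g [f' [Hf Lg Lf' ff' ->]]]] := energy_spaceP F.
have /choice[P PP] : forall j, exists Pp : R[i] * (R -> R[i]),
    [/\ L2 Pp.2, has_trace Pp.2 Pp.1 &
      distr_deriv 1 Pp.2 (fun x => 1 * Pp.2 x + (s * f' j x + g j x))].
  move=> j; have [c0 [p0 p0P]] := complex_ode_backward (L2_lin s (Lf' j) (Lg j)).
  by exists (c0, p0).
have dn0 : N%:R * s - alpha != 0.
  apply/eqP => /eqP; rewrite subr_eq0 => /eqP E; move: sa.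
  rewrite -E mulrCA ss mulr1.
  have ReN n : Re (n%:R : R[i]) = n%:R.
    by elim: n => // n IH; rewrite -!natr1 Defs.ReD IH.
  by rewrite ReN leNgt ltr0n N0.
(* The future v(0): on each edge w_j(0) = p_j(0) - s c, and the vertex condition sum_j w_j(0) +
   alpha c = 0 gives this quotient. *)
pose c := (\sum_j (P j).1) / (N%:R * s - alpha).
(* As q = p - 2 s v, this initial value forces v_j(0) = c on every edge. *)
have /choice[q qP] : forall j, exists q : R -> R[i],
    [/\ L2 q, has_trace q ((P j).1 - 2 * s * c) &
      distr_deriv 1 q (fun x => -1 * q x + (- s * f' j x + g j x))].
  by move=> j; exact: complex_ode_forward (L2_lin (- s) (Lf' j) (Lg j)).
pose p j := (P j).2.
(* Inverting p = w + s v and q = w - s v, with 1/s = s. *)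
pose v : graph_fun R N := fun j x => s / 2 * p j x + (- (s / 2)) * q j x.
pose w : graph_fun R N := fun j x => 2^-1 * p j x + 2^-1 * q j x.
pose z : graph_fun R N := fun j x => s * w j x + f' j x.
pose h : graph_fun R N := fun j x => s * v j x + g j x.
(* The first component v - s u = f of the equation, solved for u with 1/s = s. *)
pose u : graph_fun R N := fun j x => s * v j x + - s * f j x.
have Lp j : L2 (p j) by have [] := PP j.
have Lq j : L2 (q j) by have [] := qP j.
have Lv : in_L2 v by move=> j; exact: L2_comb.
have Lw : in_L2 w by move=> j; exact: L2_comb.
have Lz : in_L2 z by move=> j; exact: L2_lin.
have Lh : in_L2 h by move=> j; exact: L2_lin.
have two : (2 : R[i]) != 0 by rewrite pnatr_eq0.
have vz : graph_distr v z.
  move=> j; have [_ _ pd] := PP j; have [_ _ qd] := qP j.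
  have lp := L2_loc_integrable (Lp j); have lq := L2_loc_integrable (Lq j).
  have Lp' := L2_lin 1 (Lp j) (L2_lin s (Lf' j) (Lg j)).
  have Lq' := L2_lin (-1) (Lq j) (L2_lin (- s) (Lf' j) (Lg j)).
  have := distr_deriv_comb (s / 2) (- (s / 2)) lp lq Lp' Lq' pd qd.
  congr (distr_deriv _ _ _); apply/funext => x; rewrite /z /w -/(p j).
  rewrite [f' j x in RHS](ss1 (f' j x)); field.
  by [].
have wh : graph_distr w h.
  move=> j; have [_ _ pd] := PP j; have [_ _ qd] := qP j.
  have lp := L2_loc_integrable (Lp j); have lq := L2_loc_integrable (Lq j).
  have Lp' := L2_lin 1 (Lp j) (L2_lin s (Lf' j) (Lg j)).
  have Lq' := L2_lin (-1) (Lq j) (L2_lin (- s) (Lf' j) (Lg j)).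
  have := distr_deriv_comb 2^-1 2^-1 lp lq Lp' Lq' pd qd.
  congr (distr_deriv _ _ _); apply/funext => x; rewrite /h /v -/(p j).
  rewrite [g j x in RHS](ss1 (g j x)) [LHS]ss1; field.
  by [].
have vc j : has_trace (v j) c.
  have [_ pc _] := PP j; have [_ qc _] := qP j.
  have := has_trace_comb (s / 2) (- (s / 2)) pc qc.
  congr (has_trace _ _).
  rewrite [RHS]ss1; field.
  by [].
have wd j : has_trace (w j) ((P j).1 - s * c).
  have [_ pc _] := PP j; have [_ qc _] := qP j.
  have := has_trace_comb 2^-1 2^-1 pc qc.
  congr (has_trace _ _); field.
  by [].
have Hv := graph_distr_in_H1dot Lv Lz vz vc.
have [_ [f0 f0P]] := Hf.
have uE : u = s *: v + (- s) *: f by [].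
have Hu : in_H1dot u.
  split; last by exists (s * c + - s * f0) => j; exact: has_trace_comb.
  move=> j; split.
    have := loc_integrable_lin s (L2_loc_integrable (Lv j))
      (loc_integrable_lin (- s) (in_H1dot_loc j Hf) (loc_integrable_cst 0)).
    by congr loc_integrable; apply/funext => x; rewrite addr0.
  exists (fun x => s * z j x + - s * f' j x); first exact: L2_comb.
  exact: distr_deriv_comb (L2_loc_integrable (Lv j)) (in_H1dot_loc j Hf) _ _ _ _.
have uw : graph_distr u w.
  move=> j; have := distr_deriv_comb s (- s) (L2_loc_integrable (Lv j))
    (in_H1dot_loc j Hf) (Lz j) (Lf' j) (vz j) (ff' j).
  congr (distr_deriv _ _ _); apply/funext => x; rewrite /z.
  by rewrite mulrDr mulrA ss mul1r mulNr addrK.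
have data : wave_data alpha u v w h z (fun j => (P j).1 - s * c) c.
  split=> //.
  rewrite big_split/= sumr_const card_ord -mulr_natl.
  have -> : \sum_(j < N) (P j).1 = c * (N%:R * s - alpha) by rewrite divfK.
  ring.
exists (H1tilde_class u, L2_class v); first exact: wave_data_dom data.
rewrite (wave_data_act data) -scaleNr addrC class_lin//; congr (_, _).
- congr H1tilde_class; apply/funext => j; apply/funext => x.
  rewrite graph_fun_linE /u mulrDr !mulrA mulNr ss mulrNN ss; ring.
- congr L2_class; apply/funext => j; apply/funext => x.
  by rewrite graph_fun_linE /h mulNr addKr.
Qed.

End Surjectivity.

(** * Maximality and skew-adjointness *)

Section MaximalOperators.
Variables (R : realType) (V : lmodType R[i]) (ip : V -> V -> R[i]).
Variable W : unbounded_op V.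
Hypothesis ip_linl : forall c U U' F, ip (c *: U + U') F = c * ip U F + ip U' F.
Hypothesis ip_conj : forall U F, ip F U = (ip U F)^*%C.
Hypothesis ip_ge0 : forall U, 0 <= Re (ip U U).
Hypothesis ip_eq0 : forall U, Re (ip U U) = 0 -> U = 0.
Hypothesis dom_lin : forall c U U', dom W U -> dom W U' -> dom W (c *: U + U').
Hypothesis act_lin : forall c U U', dom W U -> dom W U' ->
  act W (c *: U + U') = c *: act W U + act W U'.
Implicit Types (U F : V) (s : R[i]).

Lemma conjN1 : (-1 : R[i])^*%C = -1.
Proof. by apply: complex_eqP => /=; rewrite ?oppr0. Qed.

Lemma ipDl U U' F : ip (U + U') F = ip U F + ip U' F.
Proof. by rewrite -[U]scale1r ip_linl scale1r mul1r. Qed.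

Lemma ipDr U U' F : ip F (U + U') = ip F U + ip F U'.
Proof. by rewrite ip_conj ipDl rmorphD/= -!ip_conj. Qed.

Lemma ip0l F : ip 0 F = 0.
Proof.
have := ipDl 0 0 F; rewrite addr0 => /esym/eqP.
by rewrite -subr_eq0 addrK => /eqP.
Qed.

Lemma ipZl c U F : ip (c *: U) F = c * ip U F.
Proof. by rewrite -[c *: U]addr0 ip_linl ip0l addr0. Qed.

Lemma ipZr c U F : ip F (c *: U) = c^*%C * ip F U.
Proof. by rewrite ip_conj ipZl rmorphM/= -ip_conj. Qed.

Lemma Re_ipC U F : Re (ip F U) = Re (ip U F).
Proof. by rewrite ip_conj; case: (ip U F). Qed.

Lemma dissipative_bound s U : s = 1 \/ s = -1 -> Re (s * ip (act W U) U) <= 0 ->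
  Re (ip U U) <= Re (ip (act W U - s *: U) (act W U - s *: U)).
Proof.
move=> hs sW.
have -> : ip (act W U - s *: U) (act W U - s *: U) =
    ip (act W U) (act W U) + ip U U - s * ip (act W U) U - s * ip U (act W U).
  have cN : (- s)^*%C = - s.
    by case: hs => ->; apply: complex_eqP => /=; rewrite ?oppr0.
  have ss : s * s = 1 by case: hs => ->; rewrite ?mulrNN mulr1.
  rewrite -scaleNr !(ipDl, ipDr) !(ipZl, ipZr) cN -[ip U U in RHS]mul1r -ss.
  by ring.
rewrite !(Defs.ReD, raddfN)/=.
have -> : Re (s * ip U (act W U)) = Re (s * ip (act W U) U).
  by case: hs => ->; rewrite ?mulN1r ?mul1r ?raddfN/= Re_ipC.
have := ip_ge0 (act W U); lra.
Qed.

(** [dissipative_bound] makes W - s injective on its domain, so any choice of preimages is a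
    two-sided inverse, with operator bound 1. *)
Lemma resolvent_of_surjective s : s = 1 \/ s = -1 ->
  (forall U, dom W U -> Re (s * ip (act W U) U) <= 0) ->
  (forall F, exists2 U, dom W U & act W U - s *: U = F) -> resolvent_set ip W s.
Proof.
move=> hs sW surj.
have /choice[S SP] : forall F, exists U, dom W U /\ act W U - s *: U = F.
  by move=> F; have [U] := surj F; exists U.
exists S; split=> //.
- move=> U dU; have [dS SE] := SP (act W U - s *: U).
  have dd : dom W (-1 *: U + S (act W U - s *: U)) by exact: dom_lin.
  have E : act W (-1 *: U + S (act W U - s *: U)) -
      s *: (-1 *: U + S (act W U - s *: U)) = 0.
    rewrite act_lin// scalerDr scalerA [s * -1]mulrC -scalerA opprD addrACA.
    by rewrite -scalerN -scalerDr SE scaleN1r addNr.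
  have := dissipative_bound hs (sW _ dd).
  rewrite E ip0l => H.
  have : -1 *: U + S (act W U - s *: U) = 0.
    by apply: ip_eq0; apply/eqP; rewrite eq_le H ip_ge0.
  by rewrite scaleN1r addrC => /eqP; rewrite subr_eq0 => /eqP.
- exists 1 => F; rewrite mul1r /ip_norm ler_sqrt//.
  have [dS SE] := SP F.
  by rewrite -[in leRHS]SE; exact: dissipative_bound hs (sW _ dS).
Qed.

(** Polarization makes W skew-symmetric, so the graph of -W lies in that of the adjoint. Conversely,
    surjectivity of W - 1 supplies a candidate in the domain, and surjectivity of W + 1 identifies
    it with the given vector. *)
Lemma skew_adjoint_of_surjective :
  (forall U, dom W U -> Re (ip (act W U) U) = 0) ->
  (forall s F, s = 1 \/ s = -1 -> exists2 U, dom W U & act W U - s *: U = F) ->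
  skew_adjoint ip W.
Proof.
move=> W0 surj.
have skew U F : dom W U -> dom W F -> ip (act W U) F = - ip U (act W F).
  move=> dU dF.
  have key c : Re (c * ip (act W U) F) = - Re (c * ip U (act W F)).
    have := W0 _ (dom_lin c dU dF).
    rewrite act_lin// !ipDl !ipDr !ipZl !ipZr !Defs.ReD.
    have -> : Re (c * (c^*%C * ip (act W U) U)) = 0.
      rewrite mulrA; have := W0 _ dU; case: c (ip _ U) => [a b] [e k] /= ->; ring.
    rewrite W0// add0r addr0.
    have -> : Re (c^*%C * ip (act W F) U) = Re (c * ip U (act W F)).
      by rewrite (ip_conj U (act W F)); case: c (ip U _) => [a b] [e k] /=; ring.
    by move/eqP; rewrite addr_eq0 => /eqP.
  (* The factors 1 and -i extract the real and the imaginary parts. *)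
  have k1 := key 1; have k2 := key (0 -i* 1).
  rewrite !mul1r in k1.
  apply: complex_eqP; first by rewrite k1; case: (ip U _).
  move: k2; case: (ip _ F) (ip U _) => [a b] [e k] /=.
  by rewrite !mul0r !mulN1r !opprK !add0r.
apply/seteqP; split=> [[F G] /= H|[F G] /= [dF ->] U dU]; last first.
  by rewrite skew// -scaleN1r ipZr conjN1 mulN1r.
(* If F were in the domain with G = - W F, then (W - 1) F would be -G - F; F0 solves this equation
   inside the domain. *)
have [F0 dF0 E0] := surj 1 (- G - F) (or_introl erefl).
(* F0 - F is orthogonal to the range of W + 1: both F and F0 pair with (W + 1) U to give the product
   of U with G + F. *)
have H0 U : dom W U -> ip (act W U - -1 *: U) (-1 *: F + F0) = 0.
  move=> dU.
  have E1 : ip (act W U - -1 *: U) F = ip U (G + F).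
    by rewrite scaleN1r opprK ipDl ipDr H.
  have E2 : ip (act W U - -1 *: U) F0 = ip U (G + F).
    rewrite scaleN1r opprK ipDl skew//.
    have -> : G + F = - (act W F0 - 1 *: F0) by rewrite E0 opprD !opprK.
    rewrite scale1r -scaleN1r ipZr ipDr -[- F0]scaleN1r ipZr conjN1.
    by ring.
  by rewrite ipDr ipZr E1 E2 conjN1 mulN1r addNr.
have FF0 : F = F0.
  have [U dU UE] := surj (-1) (-1 *: F + F0) (or_intror erefl).
  have := H0 _ dU; rewrite UE => Z.
  have : -1 *: F + F0 = 0 by apply: ip_eq0; rewrite Z.
  by rewrite scaleN1r addrC => /eqP; rewrite subr_eq0 => /eqP.
split; first by rewrite FF0.
have : act W F0 - 1 *: F0 = - G - F0 by rewrite E0 FF0.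
by rewrite scale1r => /addIr WF0; rewrite FF0 WF0 opprK.
Qed.

End MaximalOperators.

(** * Application to the wave operator *)

Section WaveOperator.
Variables (R : realType) (N : nat) (alpha : R[i]).
Local Notation W := (wave_op N alpha).
Implicit Types (U : energy_space R N).

Lemma wave_dom_lin c U U' : dom W U -> dom W U' -> dom W (c *: U + U').
Proof.
move=> /wave_dom_data[u [v [w [h [z [d [e [X ->]]]]]]]].
move=> /wave_dom_data[u' [v' [w' [h' [z' [d' [e' [X' ->]]]]]]]].
rewrite class_lin; [|exact: (wave_u X)|exact: (wave_u X')
  |exact: (wave_v X)|exact: (wave_v X')].
exact: wave_data_dom (wave_data_lin c X X').
Qed.

Lemma wave_act_lin c U U' : dom W U -> dom W U' ->
  act W (c *: U + U') = c *: act W U + act W U'.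
Proof.
move=> /wave_dom_data[u [v [w [h [z [d [e [X ->]]]]]]]].
move=> /wave_dom_data[u' [v' [w' [h' [z' [d' [e' [X' ->]]]]]]]] /=.
rewrite class_lin; [|exact: (wave_u X)|exact: (wave_u X')
  |exact: (wave_v X)|exact: (wave_v X')].
rewrite (wave_data_act (wave_data_lin c X X')) (wave_data_act X) (wave_data_act X').
by rewrite class_lin; [|exact: (wave_data_v X)|exact: (wave_data_v X')
  |exact: (wave_h X)|exact: (wave_h X')].
Qed.

(** [r] is |v(0)|^2; only its sign is used afterwards. *)
Lemma Re_wave_act U : dom W U -> exists2 r, 0 <= r &
  Re (energy_ip (act W U) U) = Re alpha * r.
Proof.
move=> /wave_dom_data[u [v [w [h [z [d [e [X ->]]]]]]]] /=.
exists (Re e ^+ 2 + Im e ^+ 2); first by rewrite addr_ge0// sqr_ge0.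
by rewrite (wave_data_act X) (Re_wave_data X).
Qed.

End WaveOperator.

Theorem theorem2p1 (R : realType) (N : nat) (hN : (0 < N)%N) (alpha : R[i]) :
  [/\ 0 <= complex.Re alpha ->
        maximal_accretive (@energy_ip R N) (wave_op N alpha),
      complex.Re alpha <= 0 ->
        maximal_dissipative (@energy_ip R N) (wave_op N alpha)
    & complex.Re alpha = 0 ->
        skew_adjoint (@energy_ip R N) (wave_op N alpha)].
Proof.
have lin := @wave_dom_lin R N alpha; have alin := @wave_act_lin R N alpha.
(* One statement for both half-planes: s = -1 serves the accretive case and s = 1 the dissipative
   one, as s W is dissipative when Re(s alpha) <= 0. *)
have res s : s = 1 \/ s = -1 -> Re (s * alpha) <= 0 ->
    resolvent_set (@energy_ip R N) (wave_op N alpha) s.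
  move=> hs sa.
  apply: (resolvent_of_surjective (@energy_ip_linl R N) (@energy_ip_conj R N)
    (@energy_ip_ge0 R N) (@energy_ip_eq0 R N)) => //.
    move=> U /Re_wave_act[r r0 E].
    have -> : Re (s * energy_ip (act (wave_op N alpha) U) U) = Re (s * alpha) * r.
      by case: hs => ->; rewrite ?mul1r ?mulN1r ?raddfN/= E ?mulNr.
    by rewrite mulr_le0_ge0.
  by move=> F; exact: wave_surjective.
split=> a0.
- split.
    by move=> U /Re_wave_act[r r0 ->]; rewrite mulr_ge0.
  exists (-1); first by rewrite /= ltrN10.
  by apply: res; [right|rewrite mulN1r raddfN/= oppr_le0].
- split.
    by move=> U /Re_wave_act[r r0 ->]; rewrite mulr_le0_ge0.
  exists 1; first by rewrite /= ltr01.
  by apply: res; [left|rewrite mul1r].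
- apply: (skew_adjoint_of_surjective (@energy_ip_linl R N) (@energy_ip_conj R N)
    (@energy_ip_eq0 R N)) => //.
    by move=> U /Re_wave_act[r r0 ->]; rewrite a0 mul0r.
  move=> s F hs; apply: wave_surjective => //.
  by case: hs => ->; rewrite ?mul1r ?mulN1r ?raddfN/= a0 ?oppr0.
Qed.
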